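(* Let $n\ge 1$ and let $\Sigma$ and $\Sigma_0$ be two compact smooth star-shaped hypersurfaces of $\mathbb{R}^{2n}$, with associated Hamiltonians $H_\Sigma$ and $H_0:=H_{\Sigma_0}$. Suppose that the Reeb flow of $(\Sigma_0,\alpha|_{\Sigma_0})$ is periodic of period $\mathrm{sys}(\Sigma_0)$ and that the Hamiltonian $H_\Sigma$ is constant along the orbits of the Hamiltonian flow of $H_0$. Then $$\mathfrak{S}(\Sigma)\ \geq\ \mathfrak{S}(\Sigma_0).$$ Moreover, equality is possible only if $\Sigma$ and $\Sigma_0$ are homothetic (i.e. $\Sigma=\lambda\Sigma_0$ for some $\lambda>0$).
   Context: Work in $\mathbb{R}^{2n}$ with coordinates $(q_1,\ldots,q_n,p_1,\ldots,p_n)$ and the $1$-form $\alpha=\frac12\sum_{i=1}^n(p_i\,dq_i-q_i\,dp_i)$. A compact smooth hypersurface $\Sigma\subset\mathbb{R}^{2n}$ is star-shaped if it bounds a domain that is star-shaped (with respect to the origin) and contains the origin in its interior; the restriction $\alpha|_\Sigma$ is then a contact form. The Hamiltonian associated to $\Sigma$ is the unique function $H_\Sigma:\mathbb{R}^{2n}\to[0,\infty)$, homogeneous of degree $2$ and smooth away from the origin, such that $\Sigma=\{H_\Sigma=1\}$. The Hamiltonian flow of a function $H$ is that of the system $\dot q=\partial H/\partial p$, $\dot p=-\partial H/\partial q$. For a $(2n-1)$-dimensional manifold $M$ with contact form $\alpha$ (i.e. $\alpha\wedge(d\alpha)^{n-1}$ is a volume form; $M$ is oriented by it), the Reeb field $X$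 is defined by $d\alpha(X,\cdot)=0$, $\alpha(X)=1$; its orbits are called characteristics. Set $$\mathrm{vol}(M,\alpha)=\frac1{n!}\int_M\alpha\wedge(d\alpha)^{n-1},\qquad \mathrm{sys}(M,\alpha)=\inf_\gamma\int_\gamma\alpha,$$ the infimum being over all closed characteristics $\gamma$ (and $\mathrm{sys}(M,\alpha)=\infty$ if there are none), and define the systolic volume $$\mathfrak{S}(M,\alpha)=\frac{\mathrm{vol}(M,\alpha)}{\mathrm{sys}(M,\alpha)^n}.$$ For a star-shaped hypersurface, $\mathrm{sys}(\Sigma)$ and $\mathfrak{S}(\Sigma)$ denote these quantities for $(\Sigma,\alpha|_\Sigma)$. The Reeb flow is periodic of period $T$ if all its orbits are closed and of the same period $T$. *)

(* Defs.v *)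
From HB Require Import structures.
From mathcomp Require Export all_boot all_order all_algebra.
From mathcomp Require Export all_fingroup.
From mathcomp Require Export all_classical all_reals all_analysis.
Export numFieldNormedType.Exports.

Set Implicit Arguments.
Unset Strict Implicit.
Unset Printing Implicit Defensive.

Import Order.TTheory GRing.Theory Num.Theory.

Local Open Scope classical_set_scope.
Local Open Scope ring_scope.

Section Calculus.
Context {R : realType} {m : nat}.
Local Notation V := 'rV[R]_m.

Definition partial (i : 'I_m) (f : V -> R) : V -> R :=
  fun x => 'D_(delta_mx 0 i) f x.

Definition smooth_on (U : set V) (f : V -> R) : Prop :=
  forall s : seq 'I_m, forall x, U x -> differentiable (foldr partial f s) x.

Definition smooth_hypersurface (S : set V) : Prop :=
  forall x, S x -> exists (U : set V) (f : V -> R),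
    [/\ open U, U x, smooth_on U f, exists v, 'D_v f x != 0
      & S `&` U = [set y | f y = 0] `&` U].

(* Initial velocities of curves in S; this is T_x S when S is a hypersurface. *)
Definition tangent (S : set V) (x v : V) : Prop :=
  exists c : R -> V,
    [/\ c 0 = x, (\forall t \near (0 : R), S (c t)) & is_derive (0 : R) 1 c v].

Definition minimal_period (g : R -> V) (T : R) : Prop :=
  [/\ 0 < T, forall t, g (t + T) = g t
    & forall s, 0 < s -> (forall t, g (t + s) = g t) -> T <= s].

Definition homothetic (S S' : set V) : Prop :=
  exists2 lam : R, 0 < lam & S = [set lam *: x | x in S'].

End Calculus.

Section Forms.
Context {R : realType} {m : nat}.
Local Notation V := 'rV[R]_m.

(* A k-form is a function of a point and of k vectors; only alternating
   multilinear ones occur below. *)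
Definition form (k : nat) : Type := V -> ('I_k -> V) -> R.

Definition form1 : form 0 := fun _ _ => 1.

(* Normalized so that dx_1 /\ ... /\ dx_k (e_1, ..., e_k) = 1. *)
Definition wedge (k l : nat) (a : form k) (b : form l) : form (k + l) :=
  fun x w => (k`! * l`!)%:R^-1 *
    \sum_(s : 'S_(k + l)) (-1) ^+ s * a x (fun i => w (s (lshift l i)))
                                    * b x (fun j => w (s (rshift k j))).

Fixpoint wedge_pow (k : nat) (a : form k) (r : nat) : form (r * k) :=
  match r return form (r * k) with
  | 0 => form1
  | r'.+1 => wedge a (@wedge_pow k a r')
  end.

(* The vectors w_i are extended to constant (commuting) vector fields, so the
   bracket terms of the invariant formula for d vanish. *)
Definition ext_d (k : nat) (a : form k) : form k.+1 :=
  fun x w => \sum_(i < k.+1)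
    (-1) ^+ i * 'D_(w i) (fun y => a y (fun j => w (lift i j))) x.

Definition pullback (d k : nat) (phi : 'rV[R]_d -> V) (a : form k)
    (u : 'rV[R]_d) (w : 'I_k -> 'rV[R]_d) : R :=
  a (phi u) (fun j => 'D_(w j) phi u).

End Forms.
Arguments form : clear implicits.
Arguments wedge_pow {R m k} a r.

(* The integral of f over [-1, 1]^d. *)
Fixpoint cube_integral {R : realType} (d : nat) : ('rV[R]_d -> \bar R) -> \bar R :=
  if d is d'.+1 then fun f =>
    (\int[lebesgue_measure]_(t in `[(-1)%R, 1%R])
       cube_integral (fun u : 'rV[R]_d' => f (row_mx (const_mx t : 'rV_1) u)))%E
  else fun f => f 0.

Section Integration.
Context {R : realType} {m d : nat}.
Local Notation V := 'rV[R]_m.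

(* For m = d.+1, these are the 2m faces x_i = +-1 of the cube [-1, 1]^m,
   parametrized by [-1, 1]^d. *)
Definition cube_face (i : 'I_m) (b : bool) (u : 'rV[R]_d.+1) : V :=
  \row_j (if j == i then (-1) ^+ b else u 0 (inord (unbump i j))).

(* The t > 0 with t *: y in S; unique for y != 0 if S is star-shaped with an
   associated Hamiltonian. *)
Definition radius (S : set V) (y : V) : R :=
  xget 0 [set t : R | 0 < t /\ S (t *: y)].

(* The central projection to S of a face of the cube: these 2m smooth charts
   cover S and overlap only along the images of the boundaries of the faces. *)
Definition radial_chart (S : set V) (i : 'I_m) (b : bool) (u : 'rV[R]_d.+1) : V :=
  radius S (cube_face i b u) *: cube_face i b u.

(* The integral of the form a over S oriented by the volume form o: chart by
   chart, [-1, 1]^d.+1 carries its standard orientation, and the sign is that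
   of the chart with respect to o. *)
Definition form_integral (S : set V) (o a : form R m d.+1) : \bar R :=
  let pull c i b u :=
    pullback (radial_chart S i b) c u (fun j => delta_mx 0 j) in
  (\sum_(i < m) \sum_(b : bool) cube_integral (fun u : 'rV[R]_d.+1 =>
     (Num.sg (pull o i b u) * pull a i b u)%:E))%E.

End Integration.

Section Symplectic.
Context {R : realType} {n : nat}.
Local Notation V := 'rV[R]_(n + n).

(* A point of R^2n is (q_1, ..., q_n, p_1, ..., p_n). *)
Definition qc (x : V) (i : 'I_n) : R := x 0 (lshift n i).
Definition pc (x : V) (i : 'I_n) : R := x 0 (rshift n i).

Definition alpha : form R (n + n) 1 := fun x w =>
  2^-1 * \sum_(i < n) (pc x i * qc (w ord0) i - qc x i * pc (w ord0) i).

Definition dalpha : form R (n + n) 2 := ext_d alpha.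

Definition star_shaped_hypersurface (S : set V) : Prop :=
  [/\ compact S, smooth_hypersurface S &
    exists D : set V,
      [/\ open D, bounded_set D, D 0,
          forall x (t : R), D x -> 0 <= t <= 1 -> D (t *: x)
        & S = closure D `\` D]].

Definition associated_hamiltonian (S : set V) (H : V -> R) : Prop :=
  [/\ forall x, 0 <= H x,
      forall (t : R) x, 0 < t -> H (t *: x) = t ^+ 2 * H x,
      smooth_on [set x | x != 0] H
    & S = [set x | H x = 1]].

Definition hamiltonian_field (H : V -> R) (x : V) : V :=
  row_mx (\row_i partial (rshift n i) H x) (\row_i - partial (lshift n i) H x).

Definition hamiltonian_orbit (H : V -> R) (g : R -> V) : Prop :=
  forall t : R, is_derive t 1 g (hamiltonian_field H (g t)).

Definition reeb_vector (S : set V) (x X : V) : Prop :=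
  [/\ tangent S x X,
      forall v, tangent S x v ->
        dalpha x (fun i => if i == ord0 then X else v) = 0
    & alpha x (fun=> X) = 1].

Definition characteristic (S : set V) (g : R -> V) : Prop :=
  forall t : R, S (g t) /\
    exists2 X, reeb_vector S (g t) X & is_derive t 1 g X.

(* Through each point of S there is one Reeb orbit, by uniqueness for ODEs. *)
Definition reeb_periodic (S : set V) (T : R) : Prop :=
  forall x, S x ->
    exists g : R -> V, [/\ characteristic S g, g 0 = x & minimal_period g T].

Definition action (g : R -> V) (T : R) : \bar R :=
  (\int[lebesgue_measure]_(t in `[0%R, T])
     (alpha (g t) (fun=> 'D_1 g t))%:E)%E.

Definition sys (S : set V) : \bar R :=
  ereal_inf [set A | exists (g : R -> V) (T : R),
    [/\ characteristic S g, minimal_period g T & A = action g T]].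

Definition contact_volume_form : form R (n + n) (1 + n.-1 * 2) :=
  wedge alpha (wedge_pow dalpha n.-1).

Definition vol (S : set V) : \bar R :=
  (n`!%:R^-1%:E * form_integral S contact_volume_form contact_volume_form)%E.

(* In \bar R, +oo^-1 = 0: the value is 0 if there is no closed characteristic. *)
Definition systolic_volume (S : set V) : \bar R := (vol S / sys S ^+ n)%E.

End Symplectic.

(* Main.v *)
(* If M is the maximum of H on Sigma_0, attained at x0, then H <= M H0 everywhere
   with equality along the closed orbit g of H0 through x0, since H is constant
   on g. Hence dH = M dH0 along g, and t |-> g(M t) / sqrt M is a closed
   characteristic of Sigma of period sys(Sigma_0) / M: this bounds sys(Sigma)
   from above. On the other hand alpha /\ (d alpha)^(n-1) at x is a multiple of
   det(x, ...), so that in the radial charts the volume of {H = 1} has density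
   H^-n up to a constant factor that depends neither on H nor on the chart;
   therefore vol(Sigma) >= M^-n vol(Sigma_0), and equality forces H = M H0. *)
From mathcomp Require Import ring lra zify.
Require Import Defs.

Set Implicit Arguments.
Unset Strict Implicit.
Unset Printing Implicit Defensive.

Import Order.TTheory GRing.Theory Num.Theory.

Local Open Scope ring_scope.

(** * Signed sums over pairings *)

(** The determinant has its source in [alpha x = omega x / 2] and [dalpha = omega]: up to a
    constant, alpha /\ (d alpha)^(n-1) is the top power of omega with x as its first argument, and
    the top power of a 2-form is a Pfaffian of its Gram matrix. With J the matrix of omega and M
    that of the vectors, the Gram matrix is M J M^T, and Pf (M J M^T) = det M Pf J. Forms being
    signed sums over permutations, all this is carried out on such sums, where the 2^n n! orderings
    of the pairs are kept rather than divided out. The constants are tracked only far enough to know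
    that they are not zero. The equality case needs more than monotonicity of the integral: equal
    volumes must give equal densities at every point. The densities are therefore treated as
    continuous functions on cubes, where the integral of a nonnegative function vanishes only if the
    function does. *)

Lemma sum_perm_fix0 (R : nmodType) m (F : 'S_m.+1 -> R) :
  \sum_(s : 'S_m.+1 | s ord0 == ord0) F s = \sum_s F (lift_perm ord0 ord0 s).
Proof.
rewrite (reindex (lift_perm ord0 ord0)); last first.
  pose ulsf (s : 'S_m.+1) k := odflt k (unlift ord0 (s (lift ord0 k))).
  have ulsfK (s : 'S_m.+1) k : s ord0 = ord0 -> lift ord0 (ulsf s k) = s (lift ord0 k).
    move=> s0; rewrite /ulsf; have := neq_lift ord0 k.
    by rewrite -(can_eq (permK s)) s0 => /unlift_some[] ? ? ->.
  pose g (s : 'S_m.+1) := if injectiveP (ulsf s) is ReflectT inj then perm inj else 1%g.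
  exists g => [s _|s /eqP s0]; apply/permP => k.
    rewrite /g; case: injectiveP => [inj|[]].
      by rewrite permE /ulsf lift_perm_lift liftK.
    by move=> a b; rewrite /ulsf !lift_perm_lift !liftK /=; apply: perm_inj.
  rewrite /g; case: injectiveP => [inj|[]].
    case: (unliftP ord0 k) => [k'|] ->; rewrite ?lift_perm_id ?s0 //.
    by rewrite lift_perm_lift permE ulsfK.
  move=> a b e; apply: (@lift_inj _ ord0); apply: (@perm_inj _ s).
  by rewrite -!ulsfK // e.
by apply: eq_bigl => s; rewrite lift_perm_id eqxx.
Qed.

(** * Pairs of consecutive positions and the permutations that preserve them *)

Section Pairs.
Variable n : nat.
Local Notation N := (n * 2)%N.
Implicit Types (i : 'I_n) (b : bool) (x : 'I_N).

Fact pos_subproof i b : (i * 2 + b < n * 2)%N.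
Proof. by rewrite -ltn_divLR // divnMDl // divn_small ?addn0 //; case: b. Qed.
Definition pos i b : 'I_N := Ordinal (pos_subproof i b).

Fact pair_of_subproof x : (x./2 < n)%N.
Proof. by rewrite -divn2 ltn_divLR. Qed.
Definition pair_of x : 'I_n := Ordinal (pair_of_subproof x).

Lemma posK x : pos (pair_of x) (odd x) = x.
Proof. by apply: val_inj; rewrite /= muln2 addnC odd_double_half. Qed.

Lemma pair_of_pos i b : pair_of (pos i b) = i.
Proof. by apply: val_inj; rewrite /= muln2 addnC half_bit_double. Qed.

Lemma odd_pos i b : odd (pos i b) = b.
Proof. by rewrite /= muln2 oddD odd_double; case: b. Qed.

Lemma pos_inj i b i' b' : pos i b = pos i' b' -> i = i' /\ b = b'.
Proof.
move=> e; split; first by rewrite -(pair_of_pos i b) e pair_of_pos.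
by rewrite -(odd_pos i b) e odd_pos.
Qed.

Definition partner x : 'I_N := pos (pair_of x) (~~ odd x).

Lemma partner_pos i b : partner (pos i b) = pos i (~~ b).
Proof. by rewrite /partner pair_of_pos odd_pos. Qed.

Lemma odd_partner x : odd (partner x) = ~~ odd x.
Proof. exact: odd_pos. Qed.

Lemma partnerK : involutive partner.
Proof. by move=> x; rewrite -[x]posK !partner_pos negbK. Qed.

Lemma partner_neq x : partner x != x.
Proof. by apply/eqP => /(congr1 (odd \o val)) /=; rewrite odd_partner; case: odd. Qed.

Definition partner_perm : 'S_N := perm (inv_inj partnerK).

Lemma big_pos (T : Type) (idx : T) (op : Monoid.com_law idx) (F : 'I_N -> T) :
  \big[op/idx]_x F x = \big[op/idx]_i op (F (pos i false)) (F (pos i true)).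
Proof.
rewrite (partition_big pair_of predT) //=; apply: eq_bigr => i _.
rewrite (bigD1 (pos i false)) ?pair_of_pos //=.
rewrite (big_pred1 (pos i true)) // => x.
apply/andP/eqP => [[/eqP <-]|->].
  case ox: (odd x); first by rewrite -ox posK.
  by rewrite -ox posK eqxx.
by rewrite pair_of_pos eqxx; split=> //; apply/eqP => /pos_inj[].
Qed.

Section Sign.
Variable R : comNzRingType.
Implicit Types (A : 'I_N -> 'I_N -> R) (s t : 'S_N).

(** For antisymmetric [A], the signed sum over all [s] is 2^n n! times the Pfaffian of [A]. *)
Definition pairing A s : R := \prod_(i < n) A (s (pos i false)) (s (pos i true)).

(** Such a [t] moves whole pairs without reversing any: the factors are only reordered, and the sign
    is +1. *)
Lemma pairing_even A t : (forall x, t (partner x) = partner (t x)) ->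
  (forall i, ~~ odd (t (pos i false))) -> pairing A t = (-1) ^+ t * pairing A 1%g.
Proof.
move=> tC tev.
have oddt x : odd (t x) = odd x.
  rewrite -[x]posK; case: (odd x); last by rewrite odd_pos (negbTE (tev _)).
  by rewrite -[true]/(~~ false) -partner_pos tC !odd_partner odd_pos (negbTE (tev _)).
have a_inj : injective (fun x => if odd x then x else t x).
  move=> x y; case ox: (odd x); case oy: (odd y) => //.
  - by move=> e; move: oy ox; rewrite -oddt -e => ->.
  - by move=> e; move: oy ox; rewrite -e oddt => ->.
  - exact: perm_inj.
(* t is the product of its restriction to the even positions and of a conjugate of it. *)
have -> : (t : bool) = false.
  have -> : t = (perm a_inj * (perm a_inj ^ partner_perm))%g.
    apply/permP => x; rewrite (permM (perm a_inj)) [perm a_inj x]permE.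
    case ox: (odd x) => /=.
      have -> : x = partner_perm (partner x) by rewrite permE partnerK.
      by rewrite permJ !permE odd_partner ox /= tC.
    have -> : t x = partner_perm (partner (t x)) by rewrite permE partnerK.
    by rewrite permJ !permE odd_partner oddt ox /=.
  by rewrite odd_permM odd_permJ addbb.
rewrite expr0 mul1r /pairing.
have pi_inj : injective (fun i => pair_of (t (pos i false))).
  move=> i j e; have /perm_inj/pos_inj[//] : t (pos i false) = t (pos j false).
  rewrite -[LHS]posK -[RHS]posK e (negbTE (tev i)).
  by rewrite (negbTE (tev j)).
rewrite [RHS](reindex_inj pi_inj) /=; apply: eq_bigr => i _.
rewrite !perm1 -[true]/(~~ false) -!partner_pos tC.
have -> // : pos (pair_of (t (pos i false))) false = t (pos i false).
by rewrite -[RHS]posK (negbTE (tev i)).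
Qed.

(** Induction on the number of reversed pairs: exchanging the two members of one of them changes the
    sign of the product and that of the permutation. *)
Lemma pairing_comm A t : (forall x y, A x y = - A y x) ->
  (forall x, t (partner x) = partner (t x)) ->
  pairing A t = (-1) ^+ t * pairing A 1%g.
Proof.
move=> Aanti; have [k] := ubnP #|[pred i | odd (t (pos i false))]|.
elim: k t => // k IHk t tk tC.
have [/forallP/(pairing_even A tC)//|] := boolP [forall i, ~~ odd (t (pos i false))].
case/forallPn => i /negbNE oi.
pose u := tperm (pos i false) (pos i true).
have uC x : u (partner x) = partner (u x).
  rewrite /u; case: tpermP => [e|e|/eqP n0 /eqP n1].
  - by rewrite -[x]partnerK e partner_pos tpermR partner_pos.
  - by rewrite -[x]partnerK e partner_pos tpermL partner_pos.
  - rewrite tpermD // eq_sym -(inj_eq (inv_inj partnerK)) partner_pos //.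
have utC x : (u * t)%g (partner x) = partner ((u * t)%g x).
  by rewrite !permM uC tC.
have uti b : (u * t)%g (pos i b) = t (pos i (~~ b)).
  by rewrite permM /u; case: b; rewrite ?tpermL ?tpermR.
have utj j b : j != i -> (u * t)%g (pos j b) = t (pos j b).
  move=> ji; rewrite permM /u tpermD //.
    by apply/eqP => /pos_inj[/esym/eqP]; rewrite (negbTE ji).
  by apply/eqP => /pos_inj[/esym/eqP]; rewrite (negbTE ji).
have -> : pairing A t = - pairing A (u * t)%g.
  rewrite /pairing (bigD1 i) //= [in RHS](bigD1 i) //= !uti Aanti mulNr.
  by congr (- (_ * _)); apply: eq_bigr => j ji; rewrite !utj.
rewrite (IHk _ _ utC); last first.
  rewrite -ltnS; apply: leq_trans tk; rewrite ltnS; apply: proper_card.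
  apply/fintype.properP; split.
    apply/fintype.subsetP => j; rewrite !inE; have [->|ji] := eqVneq j i.
      by rewrite uti.
    by rewrite utj.
  by exists i; rewrite inE // uti -partner_pos tC odd_partner oi.
rewrite odd_permM /u odd_tperm signr_addb.
have -> : pos i false != pos i true by apply/eqP => /pos_inj[].
by rewrite expr1 mulN1r mulNr opprK.
Qed.

Lemma pairing_mulg A t s : (forall x y, A x y = - A y x) ->
  (forall x, t (partner x) = partner (t x)) ->
  (-1) ^+ (t * s)%g * pairing A (t * s) = (-1) ^+ s * pairing A s.
Proof.
move=> Aanti tC; have -> : pairing A (t * s) = pairing (fun x y => A (s x) (s y)) t.
  by apply: eq_bigr => i _; rewrite !permM.
rewrite pairing_comm // odd_permM signr_addb mulrACA -signr_addb addbb mul1r.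
by congr (_ * _); apply: eq_bigr => i _; rewrite !perm1.
Qed.

Lemma partner_transitive x y : exists2 t : 'S_N,
  (forall z, t (partner z) = partner (t z)) & t x = y.
Proof.
have [->|yx] := eqVneq y (partner x).
  by exists partner_perm => [z|]; rewrite !permE.
(* The second transposition moves the partners in parallel; since the two commute, their product
   commutes with [partner]. *)
exists (tperm x y * tperm (partner x) (partner y))%g; last first.
  by rewrite permM tpermL tpermD ?partner_neq // eq_sym.
move=> z.
have E (a d c : 'I_N) : partner (tperm a d c) = tperm (partner a) (partner d) (partner c).
  exact: inj_tperm (inv_inj partnerK).
have yx' : x != partner y by rewrite -(inj_eq (inv_inj partnerK)) partnerK eq_sym.
have C : (tperm x y * tperm (partner x) (partner y))%g =
         (tperm (partner x) (partner y) * tperm x y)%g.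
  by rewrite [RHS]conjgC tpermJ !tpermD // eq_sym ?partner_neq // eq_sym.
by rewrite {1}C !permM !E !partnerK.
Qed.

End Sign.
End Pairs.

(* The permutations of the positions that preserve the pairs leave the summand
   invariant and act transitively, so each value of s^-1 0 contributes equally. *)
Lemma sum_pairing_fix0 (R : comNzRingType) n (A : 'I_(n.+1 * 2) -> 'I_(n.+1 * 2) -> R) :
  (forall x y, A x y = - A y x) ->
  \sum_(s : 'S_(n.+1 * 2)) (-1) ^+ s * pairing A s =
  (n.+1 * 2)%:R * \sum_(s : 'S_(n * 2).+1)
    (-1) ^+ s * pairing A (lift_perm ord0 ord0 s : 'S_(n.+1 * 2)).
Proof.
move=> Aanti; pose o0 : 'I_(n.+1 * 2) := ord0.
pose F (s : 'S_(n.+1 * 2)) : R := (-1) ^+ s * pairing A s.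
rewrite (partition_big (fun s : 'S_(n.+1 * 2) => (s^-1)%g o0) predT) //=.
transitivity (\sum_(j < n.+1 * 2) \sum_(s : 'S_(n.+1 * 2) | s ord0 == o0) F s).
  apply: eq_bigr => k _; have [t tC tk] := partner_transitive k o0.
  rewrite (reindex_inj (mulgI t)); apply: eq_big => s.
    by rewrite /= -(inj_eq (@perm_inj _ (t * s)%g)) permKV permM tk eq_sym.
  by move=> _; rewrite pairing_mulg.
rewrite sumr_const card_ord -[LHS]mulr_natl; congr (_ * _).
rewrite (sum_perm_fix0 (m := (n * 2).+1)); apply: eq_bigr => s _.
by rewrite /F odd_lift_perm.
Qed.

(** * The Pfaffian identity for M J M^T *)

Section PairingDet.
Variables (R : comNzRingType) (n : nat).
Local Notation N := (n * 2)%N.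
Implicit Types (M : 'M[R]_N) (x y a b : 'I_N).

(** The matrix J of the symplectic form in the order q_1, p_1, ..., q_n, p_n, with the sign
    convention of p dq - q dp. *)
Definition symp_mx : 'M[R]_N := \matrix_(a, b) ((-1) ^+ (~~ odd a) *+ (b == partner a)).

Lemma symp_mx_anti a b : symp_mx a b = - symp_mx b a.
Proof.
rewrite !mxE -(inj_eq (inv_inj (@partnerK n))) partnerK eq_sym.
case: eqP => [->|_]; last by rewrite !mulr0n oppr0.
by rewrite odd_partner negbK !mulr1n; case: odd; rewrite /= ?expr1 ?opprK.
Qed.

(** Expanding the product over all choices [f] of one index per pair and exchanging the sums, each
    [f] contributes a multiple of [\det (Nf f *m M^T)], from which [\det M] comes out. The remaining
    coefficient does not depend on [M], and the case of the identity matrix identifies it. *)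
Lemma sum_pairing_det M :
  \sum_(s : 'S_N) (-1) ^+ s * pairing (fun a b => (M *m symp_mx *m M^T) a b) s =
  \det M * \sum_(s : 'S_N) (-1) ^+ s * pairing symp_mx s.
Proof.
(* The columns of M picked at the successive positions: [f i], then its partner, the only index that
   J couples with it. *)
pose h (f : {ffun 'I_n -> 'I_N}) (k : 'I_N) :=
  if odd k then partner (f (pair_of k)) else f (pair_of k).
pose Nf f : 'M[R]_N := \matrix_(k, x) (x == h f k)%:R.
have key M' : \sum_(s : 'S_N) (-1) ^+ s * pairing (fun a b => (M' *m symp_mx *m M'^T) a b) s =
    \det M' * \sum_(f : {ffun 'I_n -> 'I_N}) (\prod_i (-1) ^+ (~~ odd (f i))) * \det (Nf f).
  have AE a b : (M' *m symp_mx *m M'^T) a b =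
      \sum_(x : 'I_N) (-1) ^+ (~~ odd x) * (M' a x * M' b (partner x)).
    rewrite -mulmxA mxE; apply: eq_bigr => x _; rewrite mxE (bigD1 (partner x)) //=.
    rewrite !mxE eqxx mulr1n big1 ?addr0 => [|y /negbTE yx].
      by rewrite mulrCA.
    by rewrite mxE yx mul0r.
  rewrite /pairing; under eq_bigr => s _.
    under eq_bigr do rewrite AE.
    rewrite bigA_distr_bigA big_distrr /=.
    over.
  rewrite exchange_big big_distrr /=; apply: eq_bigr => f _.
  rewrite mulrCA [\det M' * _]mulrC -[\det M']det_tr -det_mulmx /determinant.
  rewrite [RHS]big_distrr /=; apply: eq_bigr => s _.
  rewrite [RHS]mulrCA; congr (_ * _); rewrite big_split /=; congr (_ * _).
  rewrite (big_pos _ (fun x => _)) /=; apply: eq_bigr => i _.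
  have E k : (Nf f *m M'^T) k (s k) = M' (s k) (h f k).
    rewrite mxE (bigD1 (h f k)) //= !mxE eqxx mul1r big1 ?addr0 // => y /negbTE yx.
    by rewrite mxE yx mul0r.
  by rewrite !E /h !pair_of_pos !odd_pos.
have := key 1%:M; rewrite det1 mul1r mul1mx trmx1 mulmx1 => ->; exact: key.
Qed.

(** Only pair-preserving permutations give a nonzero product, and by [pairing_comm] they all
    contribute the same value. There is no cancellation, so the sum does not vanish in
    characteristic 0. *)
Lemma sum_pairing_symp :
  \sum_(s : 'S_N) (-1) ^+ s * pairing symp_mx s =
  (-1) ^+ n * #|[pred s : 'S_N | [forall x, s (partner x) == partner (s x)]]|%:R.
Proof.
rewrite -sum1_card natr_sum big_distrr /= [RHS]big_mkcond /=.
apply: eq_bigr => s _; rewrite inE; case: ifPn => [/forallP sC|/forallPn[x sx]].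
  rewrite pairing_comm; last by move=> x; apply/eqP.
    rewrite mulrA -signr_addb addbb mul1r mulr1 /pairing.
    under eq_bigr do rewrite !perm1 mxE odd_pos partner_pos eqxx mulr1n expr1.
    by rewrite prodr_const card_ord.
  exact: symp_mx_anti.
rewrite /pairing; suff [i si] : exists i, s (pos i true) != partner (s (pos i false)).
  by rewrite (bigD1 i) //= mxE (negbTE si) mulr0n mul0r mulr0.
exists (pair_of x); apply: contra sx; rewrite -[x]posK pair_of_pos.
by case: (odd x); rewrite partner_pos => /eqP -> //; rewrite partnerK.
Qed.

End PairingDet.

Local Open Scope classical_set_scope.

(** * The contact volume form as a determinant *)

Lemma is_derive_linear (R : realType) (V W : normedModType R) (f : V -> W) (x v : V) :
  linear f -> is_derive x v f (f v).
Proof.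
move=> lf; have c : h^-1 *: ((f \o shift x) (h *: v) - f x) @[h --> 0^'] --> f v.
  apply: cvg_near_cst; near=> h.
  by rewrite /= lf addrK scalerA mulVf ?scale1r //; near: h; exact: nbhs_dnbhs_neq.
by apply: DeriveDef; [exact: cvgP c|exact: cvg_lim c].
Unshelve. all: by end_near. Qed.

Section SympForm.
Context {R : realType} {n : nat}.
Local Notation V := 'rV[R]_(n + n).
Implicit Types (x v w : V).

Definition omega (v w : V) : R := \sum_(i < n) (pc v i * qc w i - qc v i * pc w i).

Lemma omegaC v w : omega v w = - omega w v.
Proof.
by rewrite /omega -sumrN; apply: eq_bigr => i _; rewrite opprB mulrC [qc v i * _]mulrC.
Qed.

Lemma omega_linear v : linear (omega v).
Proof.
move=> k u w; rewrite /omega scaler_sumr -big_split /=; apply: eq_bigr => i _.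
by rewrite /qc /pc !mxE /GRing.scale /=; ring.
Qed.

Lemma omegaDr v u w : omega v (u + w) = omega v u + omega v w.
Proof. by have := omega_linear v 1 u w; rewrite !scale1r. Qed.

Lemma omegaZr v k w : omega v (k *: w) = k * omega v w.
Proof.
have o0 : omega v 0 = 0.
  by have := omega_linear v (-1) 0 0; rewrite scaleN1r oppr0 addr0 scaleN1r addNr.
by have := omega_linear v k w 0; rewrite !addr0 o0 addr0.
Qed.

Lemma omegaDl v u w : omega (u + w) v = omega u v + omega w v.
Proof. by rewrite omegaC omegaDr opprD -!omegaC. Qed.

Lemma omegaZl v k w : omega (k *: w) v = k * omega w v.
Proof. by rewrite omegaC omegaZr -mulrN -omegaC. Qed.

Lemma omega_nondegenerate x : (forall v, omega x v = 0) -> x = 0.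
Proof.
move=> x0; apply/rowP => j; rewrite mxE.
have [i ->|i ->] := split_ordP j.
  have := x0 (delta_mx 0 (rshift n i)); rewrite /omega (bigD1 i) //= big1 => [|k ki].
    rewrite /qc /pc !mxE !eqxx /= eq_lrshift -[false%:R]/(0 : R); lra.
  rewrite /qc /pc !mxE !eqxx /= eq_lrshift eq_rshift (negbTE ki) -[false%:R]/(0 : R); lra.
have := x0 (delta_mx 0 (lshift n i)); rewrite /omega (bigD1 i) //= big1 => [|k ki].
  rewrite /qc /pc !mxE !eqxx /= eq_rlshift -[false%:R]/(0 : R); lra.
rewrite /qc /pc !mxE !eqxx /= eq_rlshift eq_lshift (negbTE ki) -[false%:R]/(0 : R); lra.
Qed.

Lemma alphaE x u : alpha x u = 2^-1 * omega x (u ord0).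
Proof. by []. Qed.

Lemma dalphaE x u : dalpha x u = omega (u ord0) (u ord_max).
Proof.
rewrite /dalpha /ext_d !big_ord_recl big_ord0 addr0 /=.
have D v (t : 'I_1 -> V) y : 'D_v (fun y => alpha y t) y = 2^-1 * omega v (t ord0).
  have /is_derive_linear-/(_ y v)[_ ->//] : linear (fun y => alpha y t).
  by move=> k a b; rewrite !alphaE omegaDl omegaZl mulrDr /GRing.scale /=; ring.
rewrite !D expr0 expr1 mul1r mulN1r.
have -> : lift ord0 ord0 = ord_max :> 'I_2 by apply: val_inj.
have -> : lift ord_max ord0 = ord0 :> 'I_2 by apply: val_inj.
by rewrite (omegaC (u ord_max)); field.
Qed.

Definition gram m (u : 'I_m -> V) (a b : 'I_m) : R := omega (u a) (u b).

Lemma wedge_pow_dalphaE r : exists2 c : R, c != 0 &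
  forall x u, wedge_pow dalpha r x u =
    c * \sum_(s : 'S_(r * 2)) (-1) ^+ s * pairing (gram u) s.
Proof.
elim: r => [|r [c c0 IH]].
  exists 1; first exact: oner_neq0.
  move=> x u; rewrite mul1r (big_pred1 1%g) => [|s].
    by rewrite odd_perm1 mul1r /pairing big_ord0.
  by apply/esym/eqP/permP => -[].
(* The last factor counts the permutations of the inner sum: each of them yields the same full sum
   over [s]. *)
exists ((2`! * (r * 2)`!)%:R^-1 * c * (r * 2)`!%:R) => [|x u].
  by rewrite !mulf_neq0 ?invr_neq0 // pnatr_eq0 ?muln_eq0 -?lt0n ?fact_gt0.
rewrite /= /wedge -!mulrA; congr (_ * _).
(* [L s] acts as [s] behind the two positions given to [dalpha]; translation by [L t] absorbs the
   inner permutation [t] into the outer one. *)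
pose L (s : 'S_(r * 2)) : 'S_(r.+1 * 2) := lift_perm ord0 ord0 (lift_perm ord0 ord0 s).
have L0 s b : L s (pos (ord0 : 'I_r.+1) b) = pos (ord0 : 'I_r.+1) b.
  have p0 : pos (ord0 : 'I_r.+1) false = ord0 :> 'I_(r * 2).+2 by apply: val_inj.
  have p1 : pos (ord0 : 'I_r.+1) true = lift ord0 ord0 :> 'I_(r * 2).+2 by apply: val_inj.
  by case: b; rewrite ?p0 ?p1 /L ?lift_perm_lift lift_perm_id.
have LS s k : L s (rshift 2 k) = rshift 2 (s k).
  have rE j : rshift 2 j = lift ord0 (lift ord0 j) :> 'I_(2 + r * 2) by apply: val_inj.
  by rewrite !rE !lift_perm_lift.
pose F (s : 'S_(r.+1 * 2)) := (-1) ^+ s * pairing (gram u) s.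
transitivity (c * \sum_(t : 'S_(r * 2)) \sum_(s : 'S_(r.+1 * 2)) F (L t * s)%g); last first.
  congr (_ * _); rewrite (eq_bigr (fun=> \sum_s F s)) => [|t _]; last first.
    exact/esym/(reindex_inj (mulgI (L t))).
  by rewrite sumr_const card_Sn mulr_natl.
rewrite exchange_big big_distrr /=; apply: eq_bigr => s _.
rewrite IH mulrCA; congr (_ * _); rewrite big_distrr /=; apply: eq_bigr => t _.
rewrite /F odd_permM signr_addb !odd_lift_perm /= dalphaE.
rewrite [X in _ = X * _]mulrC -!mulrA; congr (_ * _); rewrite mulrCA; congr (_ * _).
rewrite /pairing big_ord_recl !permM !L0 /gram.
congr (omega (u (s _)) (u (s _)) * _); try exact: val_inj.
apply: eq_bigr => i _.
have pE b : pos (lift ord0 i) b = rshift 2 (pos i b) :> 'I_(r.+1 * 2) by apply: val_inj.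
by rewrite !permM !pE !LS.
Qed.

End SympForm.

Section ContactVolume.
Context {R : realType} {r : nat}.
Local Notation V := 'rV[R]_(r.+1 + r.+1).

(* Orders the coordinates as q_1, p_1, ..., q_n, p_n. *)
Definition symp_index (k : 'I_(r.+1 * 2)) : 'I_(r.+1 + r.+1) :=
  if odd k then rshift r.+1 (pair_of k) else lshift r.+1 (pair_of k).

Definition frame (x : V) (u : 'I_(1 + r * 2) -> V) : 'M[R]_(r.+1 * 2, r.+1 + r.+1) :=
  \matrix_k (if unlift ord0 k is Some j then u j else x).

(** The wedge product yields the permutations that keep [x] in front; [sum_pairing_fix0] passes from
    these to all permutations, to which the Pfaffian identity applies. *)
Lemma contact_volume_form_det : exists2 c : R, c != 0 &
  forall x u, @contact_volume_form R r.+1 x u =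
    c * \det (colsub symp_index (frame x u)).
Proof.
have [c c0 E] := @wedge_pow_dalphaE R r.+1 r.
pose K : R := \sum_(s : 'S_(r.+1 * 2)) (-1) ^+ s * pairing (symp_mx R r.+1) s.
have K0 : K != 0.
  rewrite /K sum_pairing_symp mulf_neq0 ?signr_eq0 // pnatr_eq0 -lt0n.
  by apply/card_gt0P; exists 1%g; rewrite inE; apply/forallP => x; rewrite !perm1.
(* In order: the normalization of [wedge], the number of absorbed inner permutations, the constants
   of [wedge_pow dalpha] and of [alpha], the number of positions from [sum_pairing_fix0], and the
   signed sum for J. *)
exists (((1`! * (r * 2)`!)%:R^-1 * (r * 2)`!%:R * (c * 2^-1)) * ((r.+1 * 2)%:R^-1 * K)).
  by rewrite !mulf_neq0 ?invr_neq0 // pnatr_eq0 ?muln_eq0 -?lt0n ?fact_gt0.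
move=> x u; set M := colsub _ _.
pose w (k : 'I_(r.+1 * 2)) : V := if unlift ord0 k is Some j then u j else x.
have AE a b : (M *m symp_mx R r.+1 *m M^T) a b = gram w a b.
  rewrite -mulmxA mxE (big_pos _ (fun x => _)) /gram /omega; apply: eq_bigr => i _ /=.
  have JE e : (symp_mx R r.+1 *m M^T) (pos i e) b =
      (-1) ^+ (~~ e) * M b (pos i (~~ e)).
    rewrite mxE (bigD1 (pos i (~~ e))) //= big1 ?addr0 => [|k /negbTE ki].
      by rewrite !mxE partner_pos eqxx odd_pos.
    by rewrite mxE partner_pos ki mul0r.
  have ME k e : M k (pos i e) = if e then pc (w k) i else qc (w k) i.
    by rewrite !mxE /w /symp_index odd_pos pair_of_pos; case: e; case: unlift.
  by rewrite !JE !ME /= expr0 expr1 mul1r mulN1r mulrN addrC.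
rewrite -[RHS]mulrA -[X in _ * X]mulrA [K * _]mulrC -sum_pairing_det.
rewrite (sum_pairing_fix0 (A := fun a b => (M *m symp_mx R r.+1 *m M^T) a b)); last first.
  by move=> a b; rewrite !AE /gram omegaC.
rewrite [X in _ * X]mulrA mulVf ?pnatr_eq0 // mul1r.
rewrite /contact_volume_form /wedge /= -!mulrA; congr (_ * _).
pose L (s : 'S_(r * 2)) : 'S_(r * 2).+1 := lift_perm ord0 ord0 s.
pose F (s : 'S_(r * 2).+1) : R :=
  (-1) ^+ s * pairing (gram w) (lift_perm ord0 ord0 s : 'S_(r.+1 * 2)).
transitivity (c * (2^-1 * \sum_(t : 'S_(r * 2)) \sum_(s : 'S_(r * 2).+1) F (L t * s)%g));
  last first.
  rewrite [RHS]mulrCA; congr (_ * _); rewrite [RHS]mulrCA; congr (_ * _).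
  rewrite (eq_bigr (fun=> \sum_s F s)) => [|t _]; last first.
    exact/esym/(reindex_inj (mulgI (L t))).
  rewrite sumr_const card_Sn mulr_natl; congr (_ *+ _); apply: eq_bigr => s _.
  by congr (_ * _); apply: eq_bigr => i _; rewrite AE.
rewrite exchange_big !big_distrr /=; apply: eq_bigr => s _.
rewrite E mulrCA; congr (_ * _); rewrite !big_distrr /=; apply: eq_bigr => t _.
rewrite alphaE.
have sE : (-1) ^+ (L t * s)%g = (-1) ^+ t * (-1) ^+ s :> R.
  by rewrite odd_permM signr_addb odd_lift_perm.
rewrite /F sE.
suff -> : pairing (gram w) (lift_perm ord0 ord0 (L t * s)%g : 'S_(r.+1 * 2)) =
    omega x (u (s (lshift (r * 2) ord0))) *
    pairing (gram (fun j : 'I_(r * 2) => u (s (rshift 1 j)))) t.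
  have G (a b d e f : R) : a * (b * d) * (e * f) = b * (e * a * (d * f)) by ring.
  exact: G.
rewrite /pairing big_ord_recl /gram.
have wl j : w (lift ord0 j) = u j by rewrite /w liftK.
have p00 : pos (ord0 : 'I_r.+1) false = ord0 :> 'I_(r * 2).+2 by apply: val_inj.
have p01 : pos (ord0 : 'I_r.+1) true = lift ord0 ord0 :> 'I_(r * 2).+2 by apply: val_inj.
have pS i e : pos (lift ord0 i : 'I_r.+1) e = lift ord0 (lift ord0 (pos i e)) :> 'I_(r * 2).+2.
  exact: val_inj.
rewrite p00 p01 lift_perm_id lift_perm_lift permM lift_perm_id wl.
congr (omega _ (u (s _)) * _).
- by rewrite /w unlift_none.
- exact: val_inj.
apply: eq_bigr => i _.
rewrite !pS !lift_perm_lift !permM !lift_perm_lift !wl.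
by congr (omega (u (s _)) (u (s _))); apply: val_inj.
Qed.

End ContactVolume.

(** * Integrals of continuous functions over the cube *)

Lemma cvg_mx_coord (T : Type) (F : set_system T) {FF : Filter F} (U : topologicalType) m n
    (f : T -> 'M[U]_(m, n)) (M : 'M[U]_(m, n)) :
  (forall i j, f x i j @[x --> F] --> M i j) -> f x @[x --> F] --> M.
Proof.
move=> fM A [P MP PA].
have : \forall x \near F, forall ij : 'I_m * 'I_n, P ij.1 ij.2 (f x ij.1 ij.2).
  by apply: filter_forall => ij; apply: fM; exact: MP.
by apply: filterS => x Px; apply: PA => i j; exact: (Px (i, j)).
Qed.

Section SegmentIntegral.
Context {R : realType}.
Notation mu := (@lebesgue_measure R).

Lemma continuous_itv_integrable (g : R -> R) (a b : R) : continuous g ->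
  mu.-integrable `[a, b] (EFin \o g).
Proof.
move=> cg; apply: continuous_compact_integrable; first exact: segment_compact.
exact: continuous_subspaceT.
Qed.

Lemma Rintegral_continuous_eq0 (g : R -> R) (a b : R) : a < b -> continuous g ->
  (forall t, a <= t <= b -> 0 <= g t) -> (\int[mu]_(t in `[a, b]) g t)%R = 0 ->
  forall t, a <= t <= b -> g t = 0.
Proof.
move=> ab cg g0 I0 t tab; apply/eqP; rewrite eq_le g0 // andbT leNgt; apply/negP => gt0.
have [e /= e0 ge] : \forall s \near t, g t / 2 <= g s.
  apply: (cvgr_ge _ (cg t)); lra.
(* Clipped to [[a, b]], the interval keeps positive length even if [t] is an endpoint, because
   [a < b]. *)
pose p := Num.max a (t - e / 2); pose q := Num.min b (t + e / 2).
have pq : p < q by rewrite /p /q lt_min !gt_max; lra.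
have pqE s : `[p, q]%classic s -> (a <= s <= b) /\ (t - e / 2 <= s <= t + e / 2).
  by rewrite /= in_itv /= /p /q ge_max le_min; lra.
have pqI : `[p, q] `<=` `[a, b] by move=> s /pqE[]; rewrite /= in_itv.
have gpq s : `[p, q]%classic s -> g t / 2 <= g s.
  by move=> /pqE[_ st]; apply: ge; rewrite /= ltr_norml; lra.
have : (\int[mu]_(s in `[p, q]) (g t / 2)%:E <= \int[mu]_(s in `[a, b]) (g s)%:E)%E.
  apply: (@le_trans _ _ (\int[mu]_(s in `[p, q]) (g s)%:E)%E).
    apply: le_integral => //.
    - exact: (continuous_itv_integrable _ _ (@cst_continuous _ _ _)).
    - exact: continuous_itv_integrable.
    - by move=> s; rewrite inE => spq; rewrite lee_fin gpq.
  apply: ge0_subset_integral => //.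
  exact/measurable_int/continuous_itv_integrable.
rewrite integral_cst //= lebesgue_measure_itv /= lte_fin pq.
rewrite -[X in (_ <= X)%E]fineK; last first.
  exact/integrable_fin_num/continuous_itv_integrable.
rewrite -/(Rintegral mu _ _) I0 -EFinB -EFinM lee_fin leNgt => /negP; apply.
by apply: mulr_gt0; lra.
Qed.

End SegmentIntegral.

Section CubeIntegral.
Context {R : realType}.
Notation mu := (@lebesgue_measure R).

Definition cube d : set 'rV[R]_d := [set u | forall i, -1 <= u 0 i <= 1].

Lemma cube_compact d : compact (@cube d).
Proof.
have := @rV_compact R d (fun=> `[(-1), 1]%classic) (fun=> @segment_compact R _ _).
by congr compact; apply/seteqP; split=> u /= uP i; have := uP i; rewrite /= in_itv.
Qed.

Definition slice d (t : R) (u : 'rV[R]_d) : 'rV[R]_(1 + d) := row_mx (const_mx t : 'rV_1) u.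

Lemma slice_continuous d : continuous (fun p : R * 'rV[R]_d => slice p.1 p.2).
Proof.
move=> -[t u]; apply: cvg_mx_coord => i j; rewrite /slice /=.
have [k ->|k ->] := split_ordP j.
  rewrite row_mxEl mxE; under eq_fun do rewrite row_mxEl mxE.
  exact: cvg_fst.
rewrite row_mxEr; under eq_fun do rewrite row_mxEr.
apply: (@cvg_comp _ _ _ snd (fun v : 'rV[R]_d => v i k) _ (nbhs u)); first exact: cvg_snd.
exact: coord_continuous.
Qed.

Lemma slice_cube d t (u : 'rV[R]_d) : -1 <= t <= 1 -> cube u -> cube (slice t u).
Proof.
move=> t1 uc j; rewrite /slice; have [k ->|k ->] := split_ordP j.
  by rewrite row_mxEl mxE.
by rewrite row_mxEr; exact: uc.
Qed.

Lemma cube_slice d (u : 'rV[R]_d.+1) : cube u ->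
  exists t v, [/\ -1 <= t <= 1, cube v & u = slice t v].
Proof.
move=> uc; exists (u 0 (lshift d (ord0 : 'I_1))), (@rsubmx _ 1 1 d u); split.
- exact: uc.
- by move=> i; rewrite mxE; exact: uc.
- apply/matrixP => i j; rewrite /slice ord1.
  have [k ->|k ->] := @split_ordP 1 d j; apply/esym.
    by etransitivity; [exact: (@row_mxEl R 1 1 d)|rewrite mxE (ord1 k)].
  by etransitivity; [exact: (@row_mxEr R 1 1 d)|rewrite mxE].
Qed.

(** A real-valued substitute for [cube_integral] on continuous functions. The last clause, strict
    positivity, is what turns equality of volumes into equality of densities. *)
Definition is_cube_integral d (I : ('rV[R]_d -> R) -> R) :=
  [/\ forall f : 'rV[R]_d -> R, continuous f -> cube_integral (fun u => (f u)%:E) = (I f)%:E,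
     forall k (f g : 'rV[R]_d -> R), continuous f -> continuous g ->
       I (fun u => k * f u + g u) = k * I f + I g,
     forall f : 'rV[R]_d -> R, continuous f -> (forall u, cube u -> 0 <= f u) -> 0 <= I f &
     forall f : 'rV[R]_d -> R, continuous f -> (forall u, cube u -> 0 <= f u) -> I f = 0 ->
       forall u, cube u -> f u = 0].

(** Induction on the dimension. The crux is [cI]: the integral over a slice is a continuous function
    of the slice, so that the one-dimensional results apply to it. *)
Lemma cube_integral_exists d : exists I, @is_cube_integral d I.
Proof.
elim: d => [|d [I [IE Ilin Ipos I0]]].
  exists (fun f => f 0); split=> //.
  - by move=> f _ f0; apply: f0 => -[].
  - move=> f _ _ f0 u _; rewrite (_ : u = 0) //; apply/matrixP => i [//].
have cst_cont (c : R) : continuous (fun _ : 'rV[R]_d => c) by exact: cst_continuous.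
have IB (f g : 'rV[R]_d -> R) : continuous f -> continuous g ->
    I (fun u => f u - g u) = I f - I g.
  move=> cf cg; have := Ilin (-1) g f cg cf; rewrite mulN1r [in RHS]addrC => <-.
  by congr I; apply/funext => u; rewrite mulN1r addrC.
have Ile (f g : 'rV[R]_d -> R) : continuous f -> continuous g ->
    (forall u, cube u -> f u <= g u) -> I f <= I g.
  move=> cf cg fg; rewrite -subr_ge0 -IB //.
  apply: Ipos => [u|u /fg]; last by rewrite subr_ge0.
  exact: cvgB (cg u) (cf u).
have Icst c : I (fun=> c) = c * I (fun=> 1).
  have := Ilin (c - 1) (fun=> 1) (fun=> 1) (cst_cont 1) (cst_cont 1).
  by rewrite (_ : (fun _ => _) = fun=> c); [move=> ->; ring|apply/funext => u; ring].
have cslice (f : 'rV[R]_(1 + d) -> R) t :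
    continuous f -> continuous (fun u : 'rV[R]_d => f (slice t u)).
  move=> cf u; apply: (@continuous_comp _ _ _ (slice t) f); last exact: cf.
  apply: (@continuous_comp _ _ _ (pair t) (fun p => slice p.1 p.2)).
    apply: (@cvg_pair _ _ _ (nbhs u) (nbhs t) (nbhs u) _ _ _ (fun=> t) id) => //.
    exact: cvg_cst.
  exact: slice_continuous.
have cI (f : 'rV[R]_(1 + d) -> R) :
    continuous f -> continuous (fun t => I (fun u => f (slice t u))).
  move=> cf t; apply/cvgrPdist_le => e e0.
  pose I1 := I (fun=> 1); have I10 : 0 <= I1 by apply: Ipos.
  (* Only [0 <= I1] is known here; adding 1 makes the quotient meaningful and still bounds its
     product with [I1] by [e]. *)
  have d0 : 0 < e / (I1 + 1) by apply: divr_gt0 => //; lra.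
  (* Joint continuity and compactness of the cube give an estimate uniform in [u]. *)
  have cov : \forall s \near t, @cube d `<=`
      (fun u => `|f (slice t u) - f (slice s u)| <= e / (I1 + 1)).
    have /compact_near_coveringP K := @cube_compact d.
    apply: (K _ (nbhs t) (fun s u => `|f (slice t u) - f (slice s u)| <= e / (I1 + 1))).
    move=> x _.
    have : (f (slice p.1 p.2) @[p --> (t, x)] --> f (slice t x)).
      apply: (@continuous_comp _ _ _ (fun p => slice p.1 p.2) f (t, x)); last exact: cf.
      exact: slice_continuous.
    move/cvgrPdist_le/(_ (e / (I1 + 1) / 2)) => /(_ _)[|[A B] /= [At Bx] AB]; first lra.
    exists (B, A) => // -[x' s] /= [Bx' As].
    have ts := AB (s, x') (conj As Bx'); have tt := AB (t, x') (conj (nbhs_singleton At) Bx').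
    rewrite /= in ts tt.
    move: ts tt; rewrite !ler_norml; lra.
  near=> s; have cs : @cube d `<=`
      (fun u => `|f (slice t u) - f (slice s u)| <= e / (I1 + 1)) by near: s.
  rewrite -IB; [|exact: cslice|exact: cslice].
  have cts : continuous (fun u => f (slice t u) - f (slice s u)).
    by move=> u; exact: cvgB (cslice f t cf u) (cslice f s cf u).
  have dI : e / (I1 + 1) * I1 <= e.
    rewrite mulrAC ler_pdivrMr; last by lra.
    nra.
  rewrite ler_norml; apply/andP; split.
    apply: (@le_trans _ _ (I (fun=> - (e / (I1 + 1))))).
      by rewrite Icst mulNr lerN2.
    by apply: Ile => // u /cs; rewrite ler_norml => /andP[].
  apply: (@le_trans _ _ (I (fun=> e / (I1 + 1)))); last by rewrite Icst.
  by apply: Ile => // u /cs; rewrite ler_norml => /andP[].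
have Iint (f : 'rV[R]_(1 + d) -> R) : continuous f ->
    mu.-integrable `[(-1), 1] (EFin \o fun t => I (fun u => f (slice t u))).
  by move=> cf; apply: continuous_itv_integrable; exact: cI.
exists (fun f => \int[mu]_(t in `[(-1), 1]) I (fun u => f (slice t u)))%R; split.
- move=> f cf /=; rewrite /Rintegral fineK; last exact/integrable_fin_num/Iint.
  apply: eq_integral => t _; rewrite IE //; exact: cslice.
- move=> k f g cf cg; rewrite -RintegralZl ?Iint // -RintegralD ?Iint //.
    by apply: eq_Rintegral => t _; rewrite Ilin //; exact: cslice.
  rewrite (_ : EFin \o _ =
    (fun t => k%:E * (EFin \o (fun t => I (fun u => f (slice t u)))) t)%E) //.
  by apply: integrableZl => //; exact: Iint.
- move=> f cf f0; apply: Rintegral_ge0 => t; rewrite /= in_itv /= => t1.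
  by apply: Ipos => [|u uc]; [exact: cslice|apply/f0/slice_cube].
- move=> f cf f0 If0 u /cube_slice[t [v [t1 vc ->]]].
  apply: (I0 (fun v => f (slice t v))) => //; first exact: cslice.
    by move=> w wc; apply/f0/slice_cube.
  apply: (Rintegral_continuous_eq0 _ (cI f cf) _ If0) => // s s1.
  by apply: Ipos => [|w wc]; [exact: cslice|exact/f0/slice_cube].
Unshelve. all: by end_near. Qed.
End CubeIntegral.

(** * Hamiltonian and Reeb flows *)

Section Derivatives.
Context {R : realType}.

Lemma derive_comp (U V W : normedModType R) (f : V -> W) (c : U -> V) x w :
  differentiable c x -> differentiable f (c x) ->
  'D_w (f \o c) x = 'D_('D_w c x) f (c x).
Proof.
move=> dc df; rewrite (deriveE w (differentiable_comp dc df)) (diff_comp dc df) /=.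
by rewrite (deriveE w dc) (deriveE _ df).
Qed.

Lemma is_derive_comp1 (V W : normedModType R) (f : V -> W) (c : R -> V) (t : R) v :
  is_derive t 1 c v -> differentiable f (c t) ->
  is_derive t 1 (f \o c) ('D_v f (c t)).
Proof.
move=> cv df; have dc : differentiable c t by apply/derivable1_diffP.
apply: DeriveDef; first exact/derivable1_diffP/differentiable_comp.
by rewrite derive_comp // derive_val.
Qed.

Lemma is_derive_mx (V : normedModType R) m n (M : V -> 'M[R]_(m, n)) x w (dM : 'M[R]_(m, n)) :
  (forall i j, is_derive x w (fun y => M y i j) (dM i j)) -> is_derive x w M dM.
Proof.
move=> H; have dx : derivable M x w by apply/derivable_mxP => i j; exact: ex_derive.
by apply: DeriveDef => //; rewrite derive_mx //; apply/matrixP => i j; rewrite mxE derive_val.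
Qed.

Lemma is_derive_mx_coord (V : normedModType R) m n
    (M : V -> 'M[R]_(m, n)) x w (dM : 'M[R]_(m, n)) i j :
  is_derive x w M dM -> is_derive x w (fun y => M y i j) (dM i j).
Proof.
move=> [dM0 <-]; apply: DeriveDef; first exact: (derivable_mxP M x w).1.
by rewrite derive_mx // mxE.
Qed.

Lemma is_derive_scale (V : normedModType R) m n
    (k : V -> R) (g : V -> 'M[R]_(m, n)) x w dk dg :
  is_derive x w k dk -> is_derive x w g dg ->
  is_derive x w (fun y => k y *: g y) (dk *: g x + k x *: dg).
Proof.
move=> hk hg; apply: is_derive_mx => i j.
have := is_deriveM hk (is_derive_mx_coord i j hg).
rewrite (_ : _ * _ = fun y => (k y *: g y) i j); last by apply/funext => y; rewrite !mxE.
by move/is_derive_eq; apply; rewrite !mxE /GRing.scale /=; ring.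
Qed.

Lemma derive_row_sum m (f : 'rV[R]_m -> R) x v : differentiable f x ->
  'D_v f x = \sum_j v 0 j * partial j f x.
Proof.
move=> df; rewrite deriveE // {1}(row_sum_delta v) linear_sum; apply: eq_bigr => j _.
by rewrite linearZ /partial deriveE.
Qed.

Lemma is_derive_line (V : normedModType R) (x v : V) (t : R) :
  is_derive t 1 (fun s => x + s *: v) v.
Proof.
have /is_derive_linear-/(_ t 1) H : linear (fun s : R => s *: v).
  by move=> k a b; rewrite scalerDl scalerA.
have := is_deriveD (is_derive_cst x t 1) H.
by rewrite add0r scale1r.
Qed.

End Derivatives.

Lemma differentiable_invsqrt (R : realType) (r : R) : 0 < r ->
  differentiable (fun r : R => (Num.sqrt r)^-1) r.
Proof.
move=> r0; apply/derivable1_diffP/derivableV; first by rewrite gt_eqF ?sqrtr_gt0.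
by have [] := is_derive1_sqrt r0.
Qed.

(** * The Hamiltonian of a star-shaped hypersurface and its Reeb field *)

Section Hamiltonian.
Context {R : realType} {n : nat} {S : set 'rV[R]_(n + n)} {H : 'rV[R]_(n + n) -> R}.
Local Notation V := 'rV[R]_(n + n).
Hypothesis hS : star_shaped_hypersurface S.
Hypothesis hH : associated_hamiltonian S H.
Implicit Types (x y v w : V) (t : R).

Lemma hamiltonian_ge0 x : 0 <= H x. Proof. by case: hH. Qed.

Lemma hamiltonianZ t x : 0 < t -> H (t *: x) = t ^+ 2 * H x.
Proof. by case: hH => _ hZ _ _; exact: hZ. Qed.

Lemma hamiltonian_differentiable x : x != 0 -> differentiable H x.
Proof. by case: hH => _ _ sm _ x0; exact: (sm [::] x). Qed.

Lemma hamiltonian_level x : S x <-> H x = 1.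
Proof. by case: hH => _ _ _ ->. Qed.

Lemma hamiltonian0 : H 0 = 0.
Proof. have := @hamiltonianZ 2 0 (ltr0n _ _); rewrite scaler0; lra. Qed.

Lemma level_neq0 x : S x -> x != 0.
Proof.
by move=> /hamiltonian_level Hx; apply/eqP => x0; move: Hx; rewrite x0 hamiltonian0; lra.
Qed.

(** A ray on which [H] vanishes would miss [S]. But every ray leaves the bounded open domain [D],
    and its point at the supremum of the parameters staying in [D] lies in the closure of [D] but
    not in [D], hence on [S]. *)
Lemma hamiltonian_gt0 x : x != 0 -> 0 < H x.
Proof.
move=> x0; rewrite lt0r hamiltonian_ge0 andbT; apply/eqP => Hx0.
have [_ _ [D [oD [M [_ DM]] D0 Dstar SE]]] := hS.
have nx0 : 0 < `|x| by rewrite normr_gt0.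
pose A := [set t : R | 0 <= t /\ D (t *: x)].
have cx t : (s *: x) @[s --> t] --> t *: x by apply: cvgZr_tmp; exact: cvg_id.
have ubA : ubound A ((M + 1) / `|x|).
  move=> t [t0 Dt]; rewrite ler_pdivlMr // -(ger0_norm t0) -normrZ.
  by apply: (DM (M + 1)) => //; lra.
have supA : has_sup A.
  by split; [exists 0; split => //; rewrite scale0r|exists ((M + 1) / `|x|)].
have s0 : 0 <= sup A by apply: sup_upper_bound => //; split => //; rewrite scale0r.
have lts t : 0 <= t -> t < sup A -> D (t *: x).
  move=> t0 /(sup_gt supA.1)[u [u0 Du] tu].
  have -> : t *: x = (t / u) *: (u *: x).
    by rewrite scalerA divfK // gt_eqF //; apply: le_lt_trans tu.
  have up : 0 < u by apply: le_lt_trans tu.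
  apply: Dstar => //; rewrite divr_ge0 ?ler_pdivrMr //; lra.
have nD : ~ D (sup A *: x).
  move=> Ds; have : \forall s \near sup A, D (s *: x).
    by apply: (cx (sup A)); exact: open_nbhs_nbhs.
  case=> e /= e0 /(_ (sup A + e / 2)); rewrite /ball /= => De.
  have : A (sup A + e / 2).
    split; first lra.
    by apply: De; rewrite opprD addNKr normrN gtr0_norm; lra.
  by move/(sup_upper_bound supA); lra.
have cD : closure D (sup A *: x).
  move=> B /(cx (sup A))[e /= e0 eB].
  have [u [u0 Du] ue] : exists2 u, A u & sup A - e < u by apply: sup_adherent.
  exists (u *: x); split => //; apply: eB => /=.
  have := sup_upper_bound supA (conj u0 Du).
  by rewrite ltr_norml; lra.
have : S (sup A *: x) by rewrite SE.
move/hamiltonian_level; have [->|s1] := eqVneq (sup A) 0.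
  by rewrite scale0r hamiltonian0; lra.
rewrite hamiltonianZ ?lt_neqAle ?s0 1?eq_sym ?s1 // Hx0; lra.
Qed.

Lemma radiusE y : y != 0 -> radius S y = (Num.sqrt (H y))^-1.
Proof.
move=> y0; have Hy := hamiltonian_gt0 y0; rewrite /radius.
have sp : 0 < (Num.sqrt (H y))^-1 by rewrite invr_gt0 sqrtr_gt0.
apply: xget_unique.
  split => //; apply/hamiltonian_level; rewrite hamiltonianZ // exprVn sqr_sqrtr ?ltW //.
  by rewrite mulVf ?gt_eqF.
move=> t [t0 /hamiltonian_level]; rewrite hamiltonianZ // => tH.
have s0 : 0 < Num.sqrt (H y) by rewrite sqrtr_gt0.
have /eqP : (t * Num.sqrt (H y)) ^+ 2 = 1 by rewrite exprMn sqr_sqrtr ?ltW.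
rewrite sqrf_eq1 => /orP[/eqP ts|/eqP ts]; last by have := mulr_gt0 t0 s0; lra.
by apply: (mulIf (lt0r_neq0 s0)); rewrite mulVf ?gt_eqF.
Qed.

Lemma level_radial y : y != 0 -> S ((Num.sqrt (H y))^-1 *: y).
Proof.
move=> y0; have Hy := hamiltonian_gt0 y0.
apply/hamiltonian_level; rewrite hamiltonianZ ?invr_gt0 ?sqrtr_gt0 //.
by rewrite exprVn sqr_sqrtr ?ltW // mulVf ?gt_eqF.
Qed.

Lemma derive_hamiltonianZ t x v : 0 < t -> x != 0 -> 'D_v H (t *: x) = t * 'D_v H x.
Proof.
move=> t0 x0; have dHx := hamiltonian_differentiable x0.
have tx0 : t *: x != 0 by rewrite scaler_eq0 negb_or gt_eqF.
have lin : linear ( *:%R t : V -> V) by move=> k a b; rewrite scalerDr !scalerA mulrC.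
have E : 'D_v (H \o *:%R t) x = t * 'D_v H (t *: x).
  have [_ D1] := @is_derive_linear R V V ( *:%R t) x v lin.
  rewrite derive_comp; [|exact: differentiableZ|exact: hamiltonian_differentiable].
  by rewrite D1 !deriveE ?linearZ //; exact: hamiltonian_differentiable.
have E2 : 'D_v (H \o *:%R t) x = t ^+ 2 * 'D_v H x.
  rewrite (_ : H \o _ = t ^+ 2 \*: H); last by apply/funext => y; rewrite /= hamiltonianZ.
  by rewrite deriveZ //; exact: diff_derivable.
have : t * (t * 'D_v H x) = t * 'D_v H (t *: x) by rewrite -E E2; ring.
by move/(mulfI (lt0r_neq0 t0)).
Qed.

Lemma hamiltonian_euler x : x != 0 -> 'D_x H x = 2 * H x.
Proof.
move=> x0; have dHx := hamiltonian_differentiable x0.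
have D1 : is_derive (1 : R) 1 (fun s : R => H (s *: x)) ('D_x H x).
  have lin : linear (fun s : R => s *: x) by move=> k a b; rewrite scalerDl scalerA.
  have := is_derive_comp1 (@is_derive_linear R R V (fun s : R => s *: x) 1 1 lin).
  by rewrite !scale1r => /(_ _ H dHx).
have D2 : is_derive (1 : R) 1 (fun s : R => s ^+ 2 * H x) (2 * H x).
  have := is_deriveM (is_derive_id (1 : R) 1)
    (is_deriveM (is_derive_id (1 : R) 1) (is_derive_cst (H x) (1 : R) 1)).
  rewrite (_ : _ * _ = fun s : R => s ^+ 2 * H x); last first.
    by apply/funext => s; rewrite expr2 -mulrA.
  by move/is_derive_eq; apply; rewrite /GRing.scale /= -[(id * cst (H x)) 1]/(1 * H x); ring.
have : is_derive (1 : R) 1 (fun s : R => H (s *: x)) (2 * H x).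
  apply: near_eq_is_derive D2; near=> s; rewrite hamiltonianZ //; near: s.
  exact: lt_nbhsr.
by case=> _ <-; case: D1 => _ <-.
Unshelve. all: by end_near. Qed.

Lemma omega_hamiltonian_field x v : x != 0 ->
  omega (hamiltonian_field H x) v = - 'D_v H x.
Proof.
move=> x0; rewrite derive_row_sum; last exact: hamiltonian_differentiable.
rewrite big_split_ord /= /omega -big_split -sumrN /=; apply: eq_bigr => i _.
by rewrite /pc /qc row_mxEl row_mxEr !mxE; ring.
Qed.

Lemma tangent_level x v : S x -> tangent S x v <-> 'D_v H x = 0.
Proof.
move=> Sx; have x0 := level_neq0 Sx; have dHx := hamiltonian_differentiable x0.
have Hx : H x = 1 by apply/hamiltonian_level.
split=> [[c [c0 cS cv]]|Dv].
  have := is_derive_comp1 cv; rewrite c0 => /(_ _ H dHx) [_ <-].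
  have : is_derive (0 : R) 1 (H \o c) 0.
    apply: near_eq_is_derive (is_derive_cst (1 : R) (0 : R) 1).
    by near=> s; apply/esym/hamiltonian_level; near: s.
  by case.
(* The curve is the central projection to S of the line x + s v. *)
pose l (s : R) := x + s *: v.
have l0 : l 0 = x by rewrite /l scale0r addr0.
have dl : is_derive (0 : R) 1 l v by exact: is_derive_line.
exists (fun s => (Num.sqrt (H (l s)))^-1 *: l s); split.
- by rewrite l0 Hx sqrtr1 invr1 scale1r.
- near=> s; apply: level_radial; near: s.
  have lc : l s @[s --> 0] --> x.
    rewrite -l0; apply: differentiable_continuous; apply/derivable1_diffP.
    by case: dl.
  exact: (cvgr_neq0 _ lc x0).
have dH : is_derive (0 : R) 1 (H \o l) 0.
  by have := is_derive_comp1 dl; rewrite l0 => /(_ _ H dHx); rewrite Dv.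
have Hl0 : (H \o l) 0 = 1 by rewrite /= l0.
(* As ['D_v H x = 0], the projecting factor is stationary at 0 and the projected curve keeps the
   velocity [v]. *)
have ds : is_derive (0 : R) 1 (fun s => (Num.sqrt (H (l s)))^-1) 0.
  have := @is_derive_comp1 _ _ _ (fun r : R => (Num.sqrt r)^-1) (H \o l) 0 0 dH.
  rewrite derive0; apply; rewrite Hl0; exact: differentiable_invsqrt.
have := is_derive_scale ds dl.
by rewrite scale0r add0r l0 Hx sqrtr1 invr1 scale1r.
Unshelve. all: by end_near. Qed.

(** The field satisfies omega (X, v) = - dH (v), which vanishes on tangent vectors, and Euler's
    identity in degree 2 gives alpha (X) = dH (x) / 2 = H x = 1. *)
Lemma hamiltonian_field_reeb x : S x -> reeb_vector S x (hamiltonian_field H x).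
Proof.
move=> Sx; have x0 := level_neq0 Sx; split.
- apply/tangent_level => //.
  have := omega_hamiltonian_field (hamiltonian_field H x) x0.
  by have := omegaC (hamiltonian_field H x) (hamiltonian_field H x); lra.
- move=> v /(tangent_level _ Sx) Dv; rewrite dalphaE /=.
  by rewrite omega_hamiltonian_field // Dv oppr0.
- rewrite alphaE omegaC omega_hamiltonian_field // hamiltonian_euler //.
  have /hamiltonian_level -> := Sx; lra.
Qed.

Lemma reeb_vector_unique x X : reeb_vector S x X -> S x -> X = hamiltonian_field H x.
Proof.
move=> [tX dX aX] Sx; have x0 := level_neq0 Sx.
have [tY dY aY] := hamiltonian_field_reeb Sx.
have dHx := hamiltonian_differentiable x0.
apply/eqP; rewrite -subr_eq0; apply/eqP/omega_nondegenerate => v.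
set Y := hamiltonian_field H x in tY dY aY *; set Z := X - Y.
have oZ w : omega Z w = omega X w - omega Y w.
  by rewrite /Z -scaleN1r omegaDl omegaZl mulN1r.
have Zx : omega Z x = 0.
  move: aX aY; rewrite !alphaE (omegaC x X) (omegaC x Y) oZ; lra.
have Zt w : 'D_w H x = 0 -> omega Z w = 0.
  move=> /(tangent_level _ Sx) tw; have := dX _ tw; have := dY _ tw.
  by rewrite !dalphaE /= oZ => -> ->; rewrite subrr.
(* omega Z vanishes on the tangent space of S at x and on x itself. *)
have -> : v = (v - (2^-1 * 'D_v H x) *: x) + (2^-1 * 'D_v H x) *: x by rewrite subrK.
rewrite omegaDr omegaZr Zx mulr0 addr0; apply: Zt.
rewrite deriveE // linearB linearZ /= -!deriveE // hamiltonian_euler //.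
have /hamiltonian_level -> := Sx; rewrite /GRing.scale /=; lra.
Qed.

(** Through this equivalence, a hypothesis on Hamiltonian orbits applies to closed
    characteristics. *)
Lemma characteristicP g :
  characteristic S g <-> (forall t, S (g t)) /\ hamiltonian_orbit H g.
Proof.
split=> [cg|[Sg og] t].
  split=> t; have [St [X rX gX]] := cg t; first by [].
  by rewrite -(reeb_vector_unique rX St).
split=> //; exists (hamiltonian_field H (g t)) => //; exact: hamiltonian_field_reeb.
Qed.

End Hamiltonian.

(** * Action, systole and homogeneity of the Hamiltonian field *)

Section Action.
Context {R : realType} {n : nat} {S : set 'rV[R]_(n + n)} {H : 'rV[R]_(n + n) -> R}.
Hypothesis hS : star_shaped_hypersurface S.
Hypothesis hH : associated_hamiltonian S H.
Local Notation V := 'rV[R]_(n + n).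

Lemma action_characteristic g T : 0 <= T -> characteristic S g -> action g T = T%:E.
Proof.
move=> T0 cg; rewrite /action (eq_integral (cst 1%:E)) => [|t _].
  rewrite integral_cst //= lebesgue_measure_itv /= lte_fin mul1e.
  by case: ltgtP T0 => [|//|<-] _; rewrite ?sube0 // subrr.
have [_ [X [_ _ aX] gX]] := cg t.
by congr (_%:E); rewrite -[RHS]aX; congr (alpha _ _); apply/funext => _; case: gX.
Qed.

Lemma sys_ge0 : (0 <= sys S)%E.
Proof.
apply: le_ereal_inf_tmp => _ [g [T [cg [T0 _ _] ->]]].
by rewrite action_characteristic ?lee_fin // ltW.
Qed.

Lemma sys_le g T : characteristic S g -> minimal_period g T -> (sys S <= T%:E)%E.
Proof.
move=> cg mT; apply: ereal_inf_lbound; exists g, T; split => //.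
by rewrite action_characteristic //; case: mT => /ltW.
Qed.

Lemma hamiltonian_fieldZ t x : 0 < t -> x != 0 ->
  hamiltonian_field H (t *: x) = t *: hamiltonian_field H x.
Proof.
move=> t0 x0; rewrite /hamiltonian_field scale_row_mx; congr row_mx.
  by apply/rowP => j; rewrite !mxE /partial (derive_hamiltonianZ hH).
by apply/rowP => j; rewrite !mxE /partial (derive_hamiltonianZ hH) // mulrN.
Qed.

Lemma level_nonempty : (0 < n)%N -> S !=set0.
Proof.
move=> n0; pose x : V := const_mx 1.
have x0 : x != 0.
  apply/eqP => /matrixP/(_ 0 (lshift n (Ordinal n0))); rewrite !mxE => /eqP.
  by rewrite oner_eq0.
by exists ((Num.sqrt (H x))^-1 *: x); exact: (level_radial hS hH).
Qed.

End Action.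

(** * Two Hamiltonians that touch along an orbit *)

Section Comparison.
Context {R : realType} {n : nat} {S S0 : set 'rV[R]_(n + n)} {H H0 : 'rV[R]_(n + n) -> R}.
Local Notation V := 'rV[R]_(n + n).
Hypothesis hS : star_shaped_hypersurface S.
Hypothesis hS0 : star_shaped_hypersurface S0.
Hypothesis hH : associated_hamiltonian S H.
Hypothesis hH0 : associated_hamiltonian S0 H0.

Lemma max_ratio : (0 < n)%N -> exists x0, S0 x0 /\ forall y, H y <= H x0 * H0 y.
Proof.
move=> n0; have [cS0 _ _] := hS0.
have [|x0 Sx0 x0max] := @EVT_max_rV R _ H S0 (level_nonempty hS0 hH0 n0) cS0.
  apply: continuous_in_subspaceT => x; rewrite inE => /(level_neq0 hH0) xn0.
  exact/differentiable_continuous/(hamiltonian_differentiable hH).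
exists x0; split; first by rewrite inE in Sx0.
move=> y; have [->|y0] := eqVneq y 0.
  by rewrite (hamiltonian0 hH) (hamiltonian0 hH0) mulr0.
have Hy := hamiltonian_gt0 hS0 hH0 y0.
have /x0max : (Num.sqrt (H0 y))^-1 *: y \in S0 by rewrite inE; exact: (level_radial hS0 hH0).
rewrite (hamiltonianZ hH) ?invr_gt0 ?sqrtr_gt0 // exprVn sqr_sqrtr ?(ltW Hy) //.
by rewrite [_^-1 * _]mulrC ler_pdivrMr.
Qed.

(** [M * H0 - H] has a minimum at [y], so its derivative vanishes along every line through [y]. *)
Lemma derive_touching M (y v : V) : y != 0 -> (forall z, H z <= M * H0 z) -> H y = M * H0 y ->
  'D_v H y = M * 'D_v H0 y.
Proof.
move=> y0 HM Hy; pose l (s : R) := y + s *: v.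
have l0 : l 0 = y by rewrite /l scale0r addr0.
have dl (s : R) : is_derive s 1 l v by exact: is_derive_line.
have lc : l s @[s --> (0 : R)] --> y.
  by rewrite -l0; apply: differentiable_continuous; apply/derivable1_diffP; case: (dl 0).
(* On this interval the line avoids the origin, the only point where differentiability is not
   given. *)
have [e /= e0 le0] : \forall s \near (0 : R), l s != 0 by exact: (cvgr_neq0 _ lc y0).
pose f s := M * H0 (l s) - H (l s).
have df (s : R) : l s != 0 -> is_derive s 1 f (M * 'D_v H0 (l s) - 'D_v H (l s)).
  move=> ls0.
  have d1 := is_derive_comp1 (dl s) (hamiltonian_differentiable hH ls0).
  have d0 := is_derive_comp1 (dl s) (hamiltonian_differentiable hH0 ls0).
  exact: is_deriveB (is_deriveZ M d0) d1.
have : is_derive (0 : R) 1 f 0.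
  apply: (@derive1_at_min R f (- e) e 0); first lra.
  - move=> t; rewrite in_itv /= => te; have [] // := df t _.
    by apply: le0; rewrite /= sub0r normrN ltr_norml; lra.
  - by rewrite in_itv /=; lra.
  - by move=> t _; rewrite /f l0 Hy subrr subr_ge0.
move=> [_ f0]; have := df 0; rewrite l0 => /(_ y0) [_]; rewrite f0 => /esym/eqP.
by rewrite subr_eq0 => /eqP.
Qed.

(** Along the orbit the two fields differ by the factor [M], which the change of time absorbs. The
    factor 1 / sqrt M puts the curve on [S] and commutes with the field, homogeneous of degree 1. *)
Lemma rescaled_characteristic (g : R -> V) (M T : R) : 0 < M -> (forall z, H z <= M * H0 z) ->
  characteristic S0 g -> (forall t, H (g t) = M) -> minimal_period g T ->
  let c t := (Num.sqrt M)^-1 *: g (M * t) in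
  characteristic S c /\ minimal_period c (T / M).
Proof.
move=> M0 HM /(characteristicP hS0 hH0)[Sg og] Hg [T0 gT Tmin] c.
have s0 : 0 < (Num.sqrt M)^-1 by rewrite invr_gt0 sqrtr_gt0.
split; last first.
  split; first exact: divr_gt0.
  - by move=> t; rewrite /c mulrDr mulrCA divff ?mulr1 ?gt_eqF // gT.
  - move=> s ss cs; rewrite ler_pdivrMr //; apply: Tmin; first exact: mulr_gt0.
    move=> t; have := cs (t / M); rewrite /c mulrDr mulrCA divff ?mulr1 ?gt_eqF //.
    by rewrite [M * s]mulrC => /(scalerI (lt0r_neq0 s0)).
apply/(characteristicP hS hH); split=> t.
  apply/(hamiltonian_level hH); rewrite /c (hamiltonianZ hH) // Hg.
  by rewrite exprVn sqr_sqrtr ?ltW // mulVf ?gt_eqF.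
have gn0 : g (M * t) != 0 := level_neq0 hH0 (Sg _).
have HX : hamiltonian_field H (g (M * t)) = M *: hamiltonian_field H0 (g (M * t)).
  have tch v := @derive_touching M (g (M * t)) v gn0 HM.
  have {}tch v : 'D_v H (g (M * t)) = M * 'D_v H0 (g (M * t)).
    by apply: tch; rewrite Hg ((hamiltonian_level hH0 _).1 (Sg _)) mulr1.
  rewrite /hamiltonian_field scale_row_mx /partial.
  by congr row_mx; apply/rowP => j; rewrite !mxE tch ?mulrN.
rewrite /c (hamiltonian_fieldZ hH) // HX.
apply: is_deriveZ.
have lin : linear (fun s : R => M * s) by move=> k a b; rewrite /GRing.scale /=; ring.
have [dg Dg] := og (M * t).
have dfg : differentiable g (M * t) by apply/derivable1_diffP.
have DM : 'D_(M * 1) g (M * t) = M *: 'D_1 g (M * t).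
  by rewrite (deriveE (M * 1) dfg) (diff1E dfg) derive1E mulr1.
rewrite -Dg -DM.
exact: (is_derive_comp1 (@is_derive_linear R R R (fun s => M * s) t 1 lin) dfg).
Qed.

End Comparison.

(** * The volume in the radial charts *)

(** Along an affine map the two difference quotients coincide, so a directional derivative of [f] is
    enough. *)
Lemma is_derive_affine (R : realType) (U V W : normedModType R) (F : U -> V) (f : V -> W)
    (u v : U) (w : V) df :
  (forall h : R, F (h *: v + u) = h *: w + F u) ->
  is_derive (F u) w f df -> is_derive u v (f \o F) df.
Proof.
move=> Fa [fd <-].
have E : (fun h : R => h^-1 *: ((f \o F \o shift u) (h *: v) - (f \o F) u)) =
         (fun h => h^-1 *: ((f \o shift (F u)) (h *: w) - f (F u))).
  by apply/funext => h; rewrite /= Fa.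
by apply: DeriveDef; rewrite ?/derivable ?/derive E.
Qed.

(** * The faces of the cube *)

Section Face.
Context {R : realType} {r : nat}.
Local Notation m := (r.+1 + r.+1)%N.
Local Notation V := 'rV[R]_m.
Implicit Types (i k : 'I_m) (b : bool) (u : 'rV[R]_(r * 2).+1) (j : 'I_(r * 2).+1).

Local Notation face := (@cube_face R m (r * 2)).

Fact face_axis_subproof i j : (bump i j < m)%N.
Proof.
by have := ltn_ord j; rewrite /bump; lia.
Qed.
(** Inverse, away from [i], of the indexing [inord (unbump i _)] in [cube_face]. *)
Definition face_axis i j : 'I_m := Ordinal (face_axis_subproof i j).

Lemma face_axis_neq i j : face_axis i j != i.
Proof. by rewrite -val_eqE /= eq_sym neq_bump. Qed.

Lemma face_axis_inord i k : k != i -> face_axis i (inord (unbump i k)) = k.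
Proof.
move=> ki; apply: val_inj => /=; rewrite inordK ?unbumpKcond.
  by rewrite val_eqE (negbTE ki).
by have := ltn_ord k; have := ltn_ord i; move: ki; rewrite -val_eqE /= /unbump; lia.
Qed.

Lemma inord_face_axis i j : inord (unbump i (face_axis i j)) = j.
Proof. by apply: val_inj; rewrite /= bumpK inordK. Qed.

Lemma face_axis_inj i : injective (face_axis i).
Proof. by move=> j j' e; rewrite -[j](inord_face_axis i) e inord_face_axis. Qed.

Lemma cube_face_neq0 i b u : face i b u != 0.
Proof.
by apply/eqP => /rowP/(_ i); rewrite !mxE eqxx => /eqP; rewrite signr_eq0.
Qed.

Lemma cube_faceE i b u :
  face i b u = (-1) ^+ b *: delta_mx 0 i + \sum_j u 0 j *: delta_mx 0 (face_axis i j).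
Proof.
apply/rowP => k; rewrite !mxE summxE eqxx /=; have [->|ki] := eqVneq k i.
  rewrite mulr1 big1 ?addr0 // => j _.
  by rewrite !mxE eq_sym (negbTE (face_axis_neq i j)) andbF mulr0.
rewrite mulr0 add0r (bigD1 (inord (unbump i k))) //= big1 => [|j jk].
  by rewrite !mxE face_axis_inord // !eqxx mulr1 addr0.
rewrite !mxE -{1}(face_axis_inord ki) (inj_eq (@face_axis_inj i)) eq_sym (negbTE jk).
by rewrite andbF mulr0.
Qed.

Lemma cube_face_affine i b u j (h : R) :
  face i b (h *: delta_mx 0 j + u) = h *: delta_mx 0 (face_axis i j) + face i b u.
Proof.
rewrite !cube_faceE addrCA; congr (_ + _).
rewrite (eq_bigr (fun j' => (h * (j' == j)%:R) *: delta_mx 0 (face_axis i j') +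
  u 0 j' *: delta_mx 0 (face_axis i j'))) => [|j' _]; last first.
  by rewrite !mxE eqxx /= scalerDl.
rewrite big_split /=; congr (_ + _).
rewrite (bigD1 j) //= eqxx mulr1 big1 ?addr0 // => j' /negbTE ->.
by rewrite mulr0 scale0r.
Qed.

(** A coordinate of largest absolute value selects the face; its sign gives [b] and its absolute
    value [t]. *)
Lemma cube_face_cover (y : V) : y != 0 ->
  exists i b u (t : R), [/\ 0 < t, forall j, -1 <= u 0 j <= 1 & y = t *: face i b u].
Proof.
move=> y0; have [k yk] : exists k, y 0 k != 0.
  apply/existsP; apply: contraNT y0; rewrite negb_exists => /forallP y0.
  by apply/eqP/rowP => k; rewrite mxE; apply/eqP/negbNE/y0.
pose i := [arg max_(i > k | true) `|y 0 i|]%O.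
have imax k' : `|y 0 k'| <= `|y 0 i|.
  by rewrite /i; case: arg_maxP => // i' _ /(_ k' isT).
have t0 : 0 < `|y 0 i| by apply: lt_le_trans (imax k); rewrite normr_gt0.
exists i, (y 0 i < 0), (\row_j (y 0 (face_axis i j) / `|y 0 i|)), `|y 0 i|; split=> //.
  move=> j; rewrite mxE -ler_norml normrM normfV normr_id ler_pdivrMr // mul1r.
  exact: imax.
apply/rowP => k'; rewrite !mxE; have [->|ki] := eqVneq k' i.
  by rewrite mulrC -[LHS]mulr_sign_norm.
by rewrite face_axis_inord // mulrC divfK // gt_eqF.
Qed.

End Face.

(** * Determinants of frames *)

Section FrameDet.
Context {R : realType} {r : nat}.
Local Notation V := 'rV[R]_(r.+1 + r.+1).
Local Notation N := (r * 2).+2.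
Implicit Types (x : V) (w v : 'I_(1 + r * 2) -> V).

Definition frame_det x w : R := \det (colsub symp_index (frame x w)).

Lemma colsub_mulmx p q s t (f : 'I_t -> 'I_s) (A : 'M[R]_(p, q)) (B : 'M[R]_(q, s)) :
  colsub f (A *m B) = A *m colsub f B.
Proof. by apply/matrixP => i j; rewrite !mxE; apply: eq_bigr => k _; rewrite mxE. Qed.

Lemma frame0 x w k : frame x w ord0 k = x 0 k.
Proof. by rewrite mxE unlift_none. Qed.

Lemma frameS x w j k : frame x w (lift ord0 j) k = w j 0 k.
Proof. by rewrite mxE liftK. Qed.

(** The change of rows is triangular, with diagonal a, e, ..., e. The vectors [v j] have the shape
    of the derivatives of a radial chart, whose components along [x] thus drop out. *)
Lemma frame_det_scale x w v (a e : R) (c : 'I_(1 + r * 2) -> R) :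
  (forall j, v j = c j *: x + e *: w j) ->
  frame_det (a *: x) v = a * e ^+ (r * 2).+1 * frame_det x w.
Proof.
move=> vE; pose L : 'M[R]_N := \matrix_(k, l)
  match unlift ord0 k, unlift ord0 l with
  | None, None => a
  | None, Some _ => 0
  | Some j, None => c j
  | Some j, Some j' => e *+ (j == j')
  end.
have -> : frame_det (a *: x) v = \det (L *m colsub symp_index (frame x w)).
  rewrite /frame_det -colsub_mulmx; congr (\det (colsub _ _)).
  apply/matrixP => k l; rewrite [RHS]mxE [RHS]big_ord_recl [frame x w ord0 l]frame0.
  have [j ->|->] := unliftP ord0 k.
    rewrite frameS vE !mxE liftK unlift_none; congr (_ + _).
    rewrite (bigD1 j) //= big1 => [|j' jj'].
      by rewrite frameS !mxE !liftK eqxx mulr1n addr0.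
    by rewrite !mxE !liftK eq_sym (negbTE jj') mulr0n mul0r.
  rewrite frame0 !mxE unlift_none big1 ?addr0 // => j _.
  by rewrite !mxE unlift_none liftK mul0r.
rewrite det_mulmx; congr (_ * _); rewrite det_trig; last first.
  apply/is_trig_mxP => k l kl; rewrite mxE.
  case: (unliftP ord0 k) kl => [j ->|->]; case: (unliftP ord0 l) => [j' ->|->] //= kl.
  by rewrite (_ : j == j' = false) //; apply/eqP => jj'; move: kl; rewrite jj' ltnn.
rewrite big_ord_recl !mxE unlift_none; congr (_ * _).
under eq_bigr do rewrite mxE liftK eqxx mulr1n.
by rewrite prodr_const card_ord.
Qed.

(** A unipotent change of rows. Applied to a face, it moves any point to the centre of that face. *)
Lemma frame_det_shift x w (c : 'I_(1 + r * 2) -> R) :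
  frame_det (x + \sum_j c j *: w j) w = frame_det x w.
Proof.
pose L : 'M[R]_N := \matrix_(k, l)
  match unlift ord0 k, unlift ord0 l with
  | None, None => 1
  | None, Some j => c j
  | Some _, None => 0
  | Some j, Some j' => (j == j')%:R
  end.
have -> : frame_det (x + \sum_j c j *: w j) w = \det (L *m colsub symp_index (frame x w)).
  rewrite /frame_det -colsub_mulmx; congr (\det (colsub _ _)).
  apply/matrixP => k l; rewrite [RHS]mxE [RHS]big_ord_recl [frame x w ord0 l]frame0.
  have [j ->|->] := unliftP ord0 k.
    rewrite frameS !mxE liftK unlift_none mul0r add0r.
    rewrite (bigD1 j) //= big1 => [|j' jj'].
      by rewrite frameS !mxE !liftK eqxx mul1r addr0.
    by rewrite !mxE !liftK eq_sym (negbTE jj') mul0r.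
  rewrite frame0 !mxE unlift_none mul1r summxE; congr (_ + _); apply: eq_bigr => j _.
  by rewrite frameS !mxE unlift_none liftK.
rewrite det_mulmx -det_tr det_trig; last first.
  apply/is_trig_mxP => k l kl; rewrite !mxE.
  case: (unliftP ord0 k) kl => [j ->|->]; case: (unliftP ord0 l) => [j' ->|->] //= kl.
  by rewrite (_ : j' == j = false) //; apply/eqP => jj'; move: kl; rewrite jj' ltnn.
rewrite big1 ?mul1r // => k _; rewrite !mxE.
by case: unliftP => // j _; rewrite eqxx.
Qed.

Lemma symp_index_inj : injective (@symp_index r).
Proof.
move=> k l e; rewrite -[LHS]posK -[RHS]posK; move: e; rewrite /symp_index.
case: (odd k); case: (odd l) => e.
- by rewrite (rshift_inj e).
- by move/eqP: e; rewrite eq_rlshift.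
- by move/eqP: e; rewrite eq_lrshift.
- by rewrite (lshift_inj e).
Qed.

Lemma symp_index_bij : bijective (@symp_index r).
Proof. by apply: inj_card_bij symp_index_inj _; rewrite !card_ord; lia. Qed.

(** Up to sign the rows are the standard basis in some order, so the matrix is orthogonal; squaring
    spares the sign of that order. *)
Lemma frame_det_face i b : frame_det ((-1) ^+ b *: delta_mx 0 i)
  (fun j : 'I_(1 + r * 2) => delta_mx 0 (face_axis i j)) ^+ 2 = 1.
Proof.
set w := fun j => _; set x := _ *: _.
rewrite expr2 /frame_det -{2}det_tr -det_mulmx -[RHS](det1 R N); congr (\det _).
apply/matrixP => k l; rewrite !mxE.
transitivity (\sum_q frame x w k q * frame x w l q).
  rewrite (reindex symp_index) /=; last exact: onW_bij symp_index_bij.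
  by apply: eq_bigr => q _; rewrite !mxE.
have ww j j' q : w j 0 q * w j' 0 q = ((q == face_axis i j) && (j == j'))%:R.
  rewrite !mxE eqxx /=; case: eqVneq => [->|_]; last by rewrite mul0r.
  by rewrite (inj_eq (@face_axis_inj _ i)) mul1r.
have xw j q : x 0 q * w j 0 q = 0.
  rewrite !mxE eqxx /=; case: (eqVneq q i) => [->|_]; last by rewrite mulr0 mul0r.
  by rewrite eq_sym (negbTE (face_axis_neq _ _)) mulr0.
have [j ->|->] := unliftP ord0 k; have [j' ->|->] := unliftP ord0 l.
- under eq_bigr do rewrite !frameS ww.
  rewrite (inj_eq lift_inj) (bigD1 (face_axis i j)) //= eqxx big1 ?addr0 // => q /negbTE -> //.
- by rewrite big1 // => q _; rewrite frameS frame0 mulrC xw.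
- by rewrite big1 // => q _; rewrite frameS frame0 xw.
- rewrite eqxx (bigD1 i) //= big1 => [|q /negbTE qi]; rewrite !frame0 !mxE eqxx.
    by rewrite eqxx mulr1 addr0 -expr2 sqrr_sign.
  by rewrite qi mulr0 mul0r.
Qed.

End FrameDet.

(** * The volume density on a face *)

Section Density.
Context {R : realType} {r : nat} {S : set 'rV[R]_(r.+1 + r.+1)}
  {H : 'rV[R]_(r.+1 + r.+1) -> R}.
Local Notation V := 'rV[R]_(r.+1 + r.+1).
Local Notation m := (r.+1 + r.+1)%N.
Local Notation face := (@cube_face R m (r * 2)).
Hypothesis hS : star_shaped_hypersurface S.
Hypothesis hH : associated_hamiltonian S H.

Lemma radius_derivable (y w : V) : y != 0 -> derivable (radius S) y w.
Proof.
move=> y0.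
have dd : differentiable ((fun s : R => (Num.sqrt s)^-1) \o H) y.
  apply: differentiable_comp; first exact: (hamiltonian_differentiable hH).
  exact/differentiable_invsqrt/(hamiltonian_gt0 hS hH).
have E : \forall z \near y, ((fun s : R => (Num.sqrt s)^-1) \o H) z = radius S z.
  near=> z; rewrite (radiusE hS hH) //; near: z.
  exact: (cvgr_neq0 _ cvg_id y0).
by have [] := near_eq_is_derive (v := w) E (derivableP (diff_derivable dd)).
Unshelve. all: by end_near. Qed.

Lemma derive_radial_chart i b u j :
  'D_(delta_mx 0 j) (@radial_chart R m (r * 2) S i b) u =
  'D_(delta_mx 0 (face_axis i j)) (radius S) (face i b u) *: face i b u +
  radius S (face i b u) *: delta_mx 0 (face_axis i j).
Proof.
have F0 := cube_face_neq0 i b u.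
have D1 := is_derive_affine (cube_face_affine i b u j) (derivableP (radius_derivable F0)).
have D2 := is_derive_affine (cube_face_affine i b u j) (is_derive_id _ _).
by have [_] := is_derive_scale D1 D2.
Qed.

(** The derivative of the radius contributes only multiples of the base point, which the determinant
    ignores. What remains is the radius H^(-1/2) to the power 2n, times the determinant of the face
    frame, which is 1 or -1. *)
Lemma norm_pullback_contact_volume (K : R) i b u :
  (forall x w, @contact_volume_form R r.+1 x w = K * frame_det x w) ->
  `|pullback (@radial_chart R m (r * 2) S i b) (@contact_volume_form R r.+1) u
      (fun j => delta_mx 0 j)| = `|K| * (H (face i b u)) ^- r.+1.
Proof.
move=> KE; rewrite /pullback KE normrM; congr (_ * _).
have Hp := hamiltonian_gt0 hS hH (cube_face_neq0 i b u).
rewrite (frame_det_scale _ (derive_radial_chart i b u)) -exprS normrM normrX.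
rewrite (radiusE hS hH) ?cube_face_neq0 // normfV (ger0_norm (sqrtr_ge0 _)).
rewrite [X in frame_det X _]cube_faceE frame_det_shift.
have -> : `|frame_det ((-1) ^+ b *: delta_mx 0 i)
    (fun j : 'I_(1 + r * 2) => delta_mx 0 (face_axis i j)) : R| = 1.
  by apply/eqP; rewrite -sqr_norm_eq1 frame_det_face.
rewrite mulr1 exprVn (_ : (r * 2).+2 = (2 * r.+1)%N); last by lia.
by rewrite exprM sqr_sqrtr // ltW.
Qed.

Lemma cube_face_continuous i b : continuous (face i b).
Proof.
move=> u; apply: (@cvg_mx_coord _ (nbhs u)) => a k; rewrite mxE; under eq_fun do rewrite mxE.
by case: eqVneq => _; [exact: cvg_cst|exact: coord_continuous].
Qed.

Lemma hamiltonian_face_continuous (K : R) i b :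
  continuous (fun u => K * (H (face i b u)) ^- r.+1).
Proof.
move=> u; have F0 := cube_face_neq0 i b u.
have Hp := hamiltonian_gt0 hS hH F0.
have HF : H (face i b v) @[v --> u] --> H (face i b u).
  apply: (@continuous_comp _ _ _ (face i b) H); first exact: cube_face_continuous.
  exact/differentiable_continuous/(hamiltonian_differentiable hH).
have cX : (H (face i b v)) ^+ r.+1 @[v --> u] --> (H (face i b u)) ^+ r.+1.
  apply: (@continuous_comp _ _ _ (H \o face i b) (fun s : R => s ^+ r.+1)); first exact: HF.
  exact: exprn_continuous.
apply: (cvgM (cvg_cst K) (cvgV _ cX)).
by rewrite expf_neq0 // gt_eqF.
Qed.

End Density.

(** The integrated form is its own orientation form, so each chart integrates an absolute value. [K]
    is chosen before [S], so that it is common to the two hypersurfaces compared. *)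
Lemma vol_cube_integral (R : realType) r : exists2 K : R, 0 < K &
  forall (S : set 'rV[R]_(r.+1 + r.+1)) (H : 'rV[R]_(r.+1 + r.+1) -> R),
    star_shaped_hypersurface S -> associated_hamiltonian S H ->
    vol S = (r.+1`!%:R^-1%:E * \sum_(i < r.+1 + r.+1) \sum_(b : bool)
      cube_integral (fun u : 'rV[R]_(r * 2).+1 => (K * (H (cube_face i b u)) ^- r.+1)%:E))%E.
Proof.
have [K K0 KE] := @contact_volume_form_det R r.
exists `|K|; first by rewrite normr_gt0.
move=> S H hS hH; rewrite /vol /form_integral; congr (_ * _)%E.
apply: eq_bigr => i _; apply: eq_bigr => b _; congr cube_integral; apply/funext => u.
by rewrite -(norm_pullback_contact_volume hS hH) // normrEsg.
Qed.

(** * Comparison of volumes *)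

Section VolumeComparison.
Context {R : realType} {r : nat} {S S0 : set 'rV[R]_(r.+1 + r.+1)}
  {H H0 : 'rV[R]_(r.+1 + r.+1) -> R}.
Hypothesis hS : star_shaped_hypersurface S.
Hypothesis hS0 : star_shaped_hypersurface S0.
Hypothesis hH : associated_hamiltonian S H.
Hypothesis hH0 : associated_hamiltonian S0 H0.

Lemma vol_comparison (M : R) : 0 < M -> (forall y, H y <= M * H0 y) ->
  exists v v0 : R, [/\ vol S = v%:E, vol S0 = v0%:E, 0 < v0, v0 / M ^+ r.+1 <= v &
    v0 / M ^+ r.+1 = v -> forall y, H y = M * H0 y].
Proof.
move=> M0 HM.
have [K K0 vE] := vol_cube_integral R r.
have [I [IE Ilin Ipos I0]] := @cube_integral_exists R (r * 2).+1.
pose f (h : 'rV[R]_(r.+1 + r.+1) -> R) i b u : R :=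
  K * (h (@cube_face R _ (r * 2) i b u)) ^- r.+1.
pose w h : R := r.+1`!%:R^-1 * \sum_i \sum_(b : bool) I (f h i b).
have volw A h : star_shaped_hypersurface A -> associated_hamiltonian A h -> vol A = (w h)%:E.
  move=> hA hh; rewrite (vE A h hA hh) EFinM -sumEFin; congr (_ * _)%E.
  apply: eq_bigr => i _; rewrite -sumEFin; apply: eq_bigr => b _.
  rewrite -IE //; exact: (hamiltonian_face_continuous hA hh).
have cS i b : continuous (f H i b) by exact: (hamiltonian_face_continuous hS hH).
have cS0 i b : continuous (f H0 i b) by exact: (hamiltonian_face_continuous hS0 hH0).
have pS i b u : 0 < H (@cube_face R _ (r * 2) i b u).
  exact: (hamiltonian_gt0 hS hH (cube_face_neq0 i b u)).
have pS0 i b u : 0 < H0 (@cube_face R _ (r * 2) i b u).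
  exact: (hamiltonian_gt0 hS0 hH0 (cube_face_neq0 i b u)).
have f0_gt0 i b u : 0 < f H0 i b u by rewrite mulr_gt0 ?invr_gt0 ?exprn_gt0.
have I0_gt0 i b : 0 < I (f H0 i b).
  have I0_ge0 : 0 <= I (f H0 i b) by apply: Ipos => // u _; rewrite ltW.
  rewrite lt0r I0_ge0 andbT; apply/eqP => If0.
  have := I0 _ (cS0 i b) (fun u _ => ltW (f0_gt0 i b u)) If0 0.
  rewrite (_ : cube 0 = True); last first.
    by apply/propext; split=> // _ j; rewrite mxE; lra.
  by move=> /(_ Logic.I) f00; have := f0_gt0 i b 0; rewrite f00 ltxx.
(* The excess of density, nonnegative since H <= M H0. If its integrals vanish, so does [d] on every
   face, and homogeneity carries H = M H0 from the faces to all of space. *)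
pose d i b u := - (M ^- r.+1) * f H0 i b u + f H i b u.
have d_ge0 i b u : 0 <= d i b u.
  rewrite /d mulNr addrC subr_ge0 /f mulrCA ler_pM2l // -invfM -exprMn.
  rewrite lef_pV2 ?posrE ?exprn_gt0 ?mulr_gt0 //.
  by apply: lerXn2r (HM _); rewrite nnegrE ltW ?mulr_gt0.
have cd i b : continuous (d i b).
  move=> u; exact: (cvgD (cvgM (cvg_cst (- (M ^- r.+1))) (cS0 i b u)) (cS i b u)).
have Id i b : I (d i b) = - (M ^- r.+1) * I (f H0 i b) + I (f H i b).
  exact: Ilin.
have Id_ge0 i b : 0 <= I (d i b) by apply: Ipos.
have nf : 0 < r.+1`!%:R^-1 :> R by rewrite invr_gt0 ltr0n fact_gt0.
have wd : w H - w H0 / M ^+ r.+1 = r.+1`!%:R^-1 * \sum_i \sum_(b : bool) I (d i b).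
  rewrite /w -mulrA -mulrBr; congr (_ * _).
  rewrite mulr_suml -sumrB; apply: eq_bigr => i _.
  rewrite mulr_suml -sumrB; apply: eq_bigr => b _.
  by rewrite Id mulNr addrC mulrC.
have sd_ge0 i : 0 <= \sum_(b : bool) I (d i b) by apply: sumr_ge0.
exists (w H), (w H0); split.
- exact: volw.
- exact: volw.
- rewrite mulr_gt0 // big_ord_recl ltr_pwDl //.
    by rewrite big_bool addr_gt0.
  by apply: sumr_ge0 => i _; apply: sumr_ge0 => b _; rewrite ltW.
- by rewrite -subr_ge0 wd mulr_ge0 //; exact: sumr_ge0.
- move=> weq y; have [->|y0] := eqVneq y 0.
    by rewrite (hamiltonian0 hH) (hamiltonian0 hH0) mulr0.
  have [i [b [u [t [t0 uc ->]]]]] := cube_face_cover y0.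
  rewrite (hamiltonianZ hH) // (hamiltonianZ hH0) // mulrCA; congr (_ * _).
  have : \sum_i \sum_(b : bool) I (d i b) = 0.
    apply: (mulfI (lt0r_neq0 nf)); rewrite -wd mulr0 weq subrr //.
  move=> /psumr_eq0P-/(_ (fun i _ => sd_ge0 i))/(_ i isT).
  move=> /psumr_eq0P-/(_ (fun b _ => Id_ge0 i b))/(_ b isT) Idib.
  have := I0 _ (cd i b) (fun u _ => d_ge0 i b u) Idib u uc.
  rewrite /d mulNr addrC /f mulrCA => /eqP; rewrite subr_eq0 => /eqP.
  move/(mulfI (lt0r_neq0 K0)); rewrite -invfM -exprMn => /invr_inj/eqP.
  by rewrite eqrXn2 ?ltW ?mulr_gt0 // => /eqP.
Qed.

End VolumeComparison.

(** * The systolic inequality and its equality case *)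

Theorem proposition1 (R : realType) (n : nat) (hn : (1 <= n)%N)
    (S S0 : set 'rV[R]_(n + n)) (H H0 : 'rV[R]_(n + n) -> R)
    (hS : star_shaped_hypersurface S)
    (hS0 : star_shaped_hypersurface S0)
    (hH : associated_hamiltonian S H)
    (hH0 : associated_hamiltonian S0 H0)
    (hper : exists2 T : R, sys S0 = T%:E & reeb_periodic S0 T)
    (hconst : forall g : R -> 'rV[R]_(n + n), hamiltonian_orbit H0 g ->
       forall t : R, H (g t) = H (g 0)) :
  (systolic_volume S0 <= systolic_volume S)%E /\
  (systolic_volume S = systolic_volume S0 -> homothetic S S0).
Proof.
case: n hn S S0 H H0 hS hS0 hH hH0 hper hconst => // r hn S S0 H H0 hS hS0 hH hH0.
move=> [T sysT per] hconst.
have [x0 [Sx0 HM]] := max_ratio hS0 hH hH0 hn.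
have M0 := hamiltonian_gt0 hS hH (level_neq0 hH0 Sx0); set M := H x0 in HM M0.
have [g [cg g0 mg]] := per x0 Sx0.
have [Sg og] := (characteristicP hS0 hH0 g).1 cg.
have Hg t : H (g t) = M by rewrite hconst // g0.
have [cc mc] := rescaled_characteristic hS hS0 hH hH0 M0 HM cg Hg mg.
have sysle := sys_le cc mc.
have T0 : 0 < T by case: mg.
have [v [v0 [vE v0E v0_gt0 vle veq]]] := vol_comparison hS hS0 hH hH0 M0 HM.
(* Finite: between 0 and the period of the rescaled orbit. *)
have [s sE] : exists s, sys S = s%:E.
  by move: (@sys_ge0 R r.+1 S) sysle; case: (sys S) => // s; exists s.
have Mn : 0 < M ^+ r.+1 by rewrite exprn_gt0.
have v_gt0 : 0 < v by apply: lt_le_trans vle; rewrite divr_gt0.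
have s_ge0 : 0 <= s by have := @sys_ge0 R r.+1 S; rewrite sE lee_fin.
have s_le : s <= T / M by rewrite -lee_fin -sE.
have Tn : 0 < T ^+ r.+1 by rewrite exprn_gt0.
have svS0 : systolic_volume S0 = (v0 / T ^+ r.+1)%:E.
  by rewrite /systolic_volume v0E sysT -EFin_expe inver gt_eqF // EFinM.
have homo : (forall y, H y = M * H0 y) -> homothetic S S0.
  move=> HE; exists (Num.sqrt M)^-1; first by rewrite invr_gt0 sqrtr_gt0.
  have sM : 0 < Num.sqrt M by rewrite sqrtr_gt0.
  apply/seteqP; split=> [x Sx|_ [x Sx <-]].
    exists (Num.sqrt M *: x); last by rewrite scalerA mulVf ?scale1r // gt_eqF.
    apply/(hamiltonian_level hH0); rewrite (hamiltonianZ hH0) // sqr_sqrtr ?(ltW M0) //.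
    by rewrite -HE; apply/(hamiltonian_level hH).
  apply/(hamiltonian_level hH); rewrite (hamiltonianZ hH) ?invr_gt0 // HE.
  by rewrite ((hamiltonian_level hH0 _).1 Sx) mulr1 exprVn sqr_sqrtr ?(ltW M0) //
    mulVf // gt_eqF.
(* sys S = 0 is not excluded: the systolic volume is then +oo, as 0^-1 = +oo in \bar R. *)
have [s0|s0] := eqVneq s 0.
  have -> : systolic_volume S = +oo%E.
    rewrite /systolic_volume vE sE s0 -EFin_expe expr0n /= inve0.
    by rewrite gt0_muley // lte_fin.
  by rewrite leey svS0.
have sp : 0 < s by rewrite lt0r s0.
have -> : systolic_volume S = (v / s ^+ r.+1)%:E.
  by rewrite /systolic_volume vE sE -EFin_expe inver gt_eqF ?exprn_gt0 // EFinM.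
(* The intermediate term separates the two estimates: this inequality is the bound on the volume,
   the next one the bound on the systole. *)
have svle : v0 / T ^+ r.+1 <= v * M ^+ r.+1 / T ^+ r.+1.
  by rewrite ler_pM2r ?invr_gt0 // -ler_pdivrMr.
have sM : v * M ^+ r.+1 / T ^+ r.+1 <= v / s ^+ r.+1.
  rewrite -mulrA ler_pM2l // -invf_div -expr_div_n lef_pV2 ?posrE ?exprn_gt0 ?divr_gt0 //.
  by apply: lerXn2r s_le; rewrite nnegrE // divr_ge0 ?ltW.
split; first by rewrite svS0 lee_fin (le_trans svle).
(* Equality of the outer terms makes the volume bound sharp, which is the equality case of
   [vol_comparison]. *)
rewrite svS0 => -[e]; apply/homo/veq/le_anti; rewrite vle /=.
move: sM; rewrite e ler_pM2r ?invr_gt0 // => vM.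
by rewrite ler_pdivlMr.
Qed.
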